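(* Let $A$ be a scalar type spectral operator in a complex Banach space $X$. Then $A$ generates an immediately norm-continuous $C_0$-semigroup (of scalar type spectral operators) on $X$ if and only if, for every $b\in\mathbb{R}$, the set $\{\lambda\in\sigma(A) : \operatorname{Re}\lambda\ge b\}$ is bounded.
   Context: A scalar type spectral operator in a complex Banach space $X$ is a densely defined closed linear operator $A$ in $X$ for which there is a strongly $\sigma$-additive spectral measure $E_A(\cdot)$ (the resolution of the identity), assigning to Borel subsets of $\mathbb{C}$ bounded projection operators on $X$ (with $E_A(\emptyset)=0$, $E_A(\mathbb{C})=I$, $E_A(\delta\cap\delta')=E_A(\delta)E_A(\delta')$), whose support is the spectrum $\sigma(A)$, and such that $A=\int_{\sigma(A)}\lambda\,dE_A(\lambda)$. Here, for a Borel measurable $F:\sigma(A)\to\mathbb{C}$, $F(A)=\int_{\sigma(A)}F(\lambda)\,dE_A(\lambda)$ is the operator $F(A)f=\lim_{n\to\infty}\int_{\{|F|\le n\}}F(\lambda)\,dE_A(\lambda)f$, with domain all $f\in X$ for which the limit exists. A $C_0$-semigroup $\{T(t)\}_{t\ge 0}$ on $X$ is immediately norm-continuous if the map $(0,\infty)\ni t\mapsto T(t)\in L(X)$ is continuous in the operator norm, where $L(X)$ is the space of bounded linear operators on $X$. *)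

(* Defs.v *)
From HB Require Import structures.
From mathcomp Require Export all_boot all_order all_algebra.
From mathcomp Require Export all_classical all_reals all_analysis.
From mathcomp Require Export complex.

Set Implicit Arguments.
Unset Strict Implicit.
Unset Printing Implicit Defensive.

Import Order.TTheory GRing.Theory Num.Theory.
Import numFieldNormedType.Exports.

Local Open Scope classical_set_scope.
Local Open Scope ring_scope.
Local Open Scope complex_scope.

(* The modulus topology on the complex numbers: the library puts a topology on
   the carrier of an abstract numFieldType, and on R[i]^o, but not on R[i]. *)
#[export, non_forgetful_inheritance]
HB.instance Definition _ (R : realType) := NormedModule.copy R[i] R[i]^o.

Section Operators.
Variables (R : realType) (X : completeNormedModType R[i]).

(* A partially defined map in X; the values of [op] off [dom] are junk, so that
   equality of operators is [op_equiv]. *)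
Record operator := Operator { dom : set X ; op :> X -> X }.

Definition total_operator (T : X -> X) : operator := Operator setT T.

Definition op_equiv (A B : operator) : Prop :=
  dom A = dom B /\ forall f, dom A f -> A f = B f.

Definition linear_operator (A : operator) : Prop :=
  dom A 0 /\
  forall (a : R[i]) f g, dom A f -> dom A g ->
    dom A (a *: f + g) /\ A (a *: f + g) = a *: A f + A g.

Definition densely_defined (A : operator) : Prop := dense (dom A).

Definition closed_operator (A : operator) : Prop :=
  closed [set p : X * X | dom A p.1 /\ A p.1 = p.2].

Definition bounded_operator (T : X -> X) : Prop := linear T /\ continuous T.

(* The norm of X takes its values in R[i], on the nonnegative real axis. *)
Definition opnorm (T : X -> X) : R :=
  sup [set complex.Re `|T f| | f in [set f : X | `|f| <= 1]].

Definition resolvent_set (A : operator) : set R[i] :=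
  [set lambda | exists S : X -> X, [/\ bounded_operator S,
     forall g, dom A (S g) /\ A (S g) - lambda *: S g = g &
     forall f, dom A f -> S (A f - lambda *: f) = f]].

Definition spectrum (A : operator) : set R[i] := ~` resolvent_set A.

End Operators.

Section SpectralMeasures.
Variables (R : realType) (X : completeNormedModType R[i]).

Definition borel : set (set R[i]) := <<s @open R[i] >>.

Record spectral_measure (E : set R[i] -> X -> X) : Prop := SpectralMeasure {
  spectral_bounded : forall d, borel d -> bounded_operator (E d) ;
  spectral_proj : forall d, borel d -> E d \o E d = E d ;
  spectral_set0 : E set0 = (fun=> 0) ;
  spectral_setT : E setT = id ;
  spectral_setI : forall d d', borel d -> borel d' ->
    E (d `&` d') = E d \o E d' ;
  spectral_sigma_additive : forall d : nat -> set R[i],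
    (forall n, borel (d n)) -> trivIset setT d ->
    forall f : X,
      (\sum_(0 <= k < n) E (d k) f) @[n --> \oo] --> E (\bigcup_n d n) f }.

Definition spectral_support (E : set R[i] -> X -> X) : set R[i] :=
  [set lambda | forall U, open U -> U lambda -> E U <> (fun=> 0)].

Definition simple_function (s : R[i] -> R[i]) : Prop :=
  finite_set (range s) /\ forall c, borel (s @^-1` [set c]).

Definition simple_integral (E : set R[i] -> X -> X) (S : set R[i])
    (s : R[i] -> R[i]) : X -> X :=
  fun f => \sum_(c \in range s) c *: E (S `&` s @^-1` [set c]) f.

(* The integral over S of a Borel function F that is bounded on S: the limit in
   operator norm of the integrals of simple functions tending to F uniformly
   on S. *)
Definition is_bounded_integral (E : set R[i] -> X -> X) (S : set R[i])
    (F : R[i] -> R[i]) (T : X -> X) : Prop :=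
  bounded_operator T /\
  exists s : nat -> R[i] -> R[i],
    [/\ forall n, simple_function (s n),
        {uniform S, s @ \oo --> F} &
        opnorm (fun f => simple_integral E S (s n) f - T f) @[n --> \oo]
          --> (0 : R)].

Definition bounded_integral (E : set R[i] -> X -> X) (S : set R[i])
    (F : R[i] -> R[i]) : X -> X :=
  xget (fun=> 0) [set T | is_bounded_integral E S F T].

Definition truncated_integral (E : set R[i] -> X -> X) (S : set R[i])
    (F : R[i] -> R[i]) (f : X) (n : nat) : X :=
  bounded_integral E (S `&` [set lambda | `|F lambda| <= n%:R]) F f.

Definition spectral_integral (E : set R[i] -> X -> X) (S : set R[i])
    (F : R[i] -> R[i]) : operator X :=
  Operator [set f | cvgn (truncated_integral E S F f)]
           (fun f => limn (truncated_integral E S F f)).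

Definition is_resolution_of_identity (A : operator X)
    (E : set R[i] -> X -> X) : Prop :=
  [/\ spectral_measure E, spectral_support E = spectrum A &
      op_equiv A (spectral_integral E (spectrum A) id)].

Definition scalar_type_spectral (A : operator X) : Prop :=
  [/\ linear_operator A, densely_defined A, closed_operator A &
      exists E, is_resolution_of_identity A E].

End SpectralMeasures.

Section Semigroups.
Variables (R : realType) (X : completeNormedModType R[i]).

(* Only the values T t with t >= 0 are meaningful. *)
Record C0_semigroup (T : R -> X -> X) : Prop := C0Semigroup {
  semigroup_bounded : forall t, 0 <= t -> bounded_operator (T t) ;
  semigroup0 : T 0 = id ;
  semigroupD : forall s t, 0 <= s -> 0 <= t -> T (s + t) = T s \o T t ;
  semigroup_cvg0 : forall f, T t f @[t --> 0^'+] --> f }.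

Definition generator (T : R -> X -> X) : operator X :=
  let q f := (fun t : R => (t^-1)%:C *: (T t f - f)) in
  Operator [set f | cvg (q f @ 0^'+)] (fun f => lim (q f @ 0^'+)).

Definition generates (A : operator X) (T : R -> X -> X) : Prop :=
  op_equiv A (generator T).

Definition immediately_norm_continuous (T : R -> X -> X) : Prop :=
  forall t0, 0 < t0 ->
    opnorm (fun f => T t f - T t0 f) @[t --> t0] --> (0 : R).

End Semigroups.

(* Main.v *)
(** The operator norm of a spectral integral of F is comparable with the
    supremum of |F|: a strongly sigma-additive family of projections is bounded
    on each vector, hence uniformly by the Banach-Steinhaus theorem.

    If T is a norm-continuous semigroup generated by A, a point lam of the
    spectrum of A is an approximate eigenvalue, with eigenvectors in the range
    of E on small balls around lam, and then exp (t lam) is an approximate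
    eigenvalue of T t.  So |exp (t lam) - exp lam| <= |T t - T 1|, and for
    Re lam >= b this gives |exp (h lam) - 1| <= 1/2 for all small real h, which
    bounds Re lam above and, taking h = pi / Im lam, also bounds |Im lam|.

    Conversely, if the spectrum is bounded in each right half-plane, then
    exp (t z) is bounded on it for t >= 0, and tends to exp (t0 z) uniformly on
    it as t -> t0 > 0, because both are small where Re z is very negative.  The
    generator of T t = exp (t A) is A since (exp (t z) - 1) / t is z times a
    bounded function that tends to 1 as t -> 0.

    A generator determines its semigroup on the dense set of vectors of bounded
    spectral support, so T t = exp (t A) always, and the resolution of the
    identity of exp (t A) is the image of E under z |-> exp (t z). *)
From mathcomp Require Import finmap.
Require Import Defs.
From mathcomp Require Import ring lra.

Set Implicit Arguments.
Unset Strict Implicit.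
Unset Printing Implicit Defensive.

Import Order.TTheory GRing.Theory Num.Theory.
Import numFieldNormedType.Exports.

Local Open Scope classical_set_scope.
Local Open Scope ring_scope.
Local Open Scope complex_scope.

(** * Real-valued norms and uniform boundedness *)

(** The definitions fix a bounded integral by choosing among admissible operators. A relation
    [is_calculus] is therefore set up, in which simple functions approximate the symbol uniformly
    while their integrals approximate the operator in norm. Its existence, uniqueness and
    multiplicativity are proved, and the chosen integral is shown to be its value; later operator
    estimates are then estimates of symbols. The bound of an operator by a constant times a bound of
    its symbol starts from sets. Coefficients in [0,1] are dominated by subfamilies, whose sums are
    again values of [E]; an affine rescaling and a split into real and imaginary parts give complex
    coefficients. Identities that usually arise by integrating along an orbit become telescoping
    sums over steps of length t / N. This carries approximate eigenvectors from A to T t and also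
    compares two semigroups with the same generator. The generator of exp (t A) is no larger than A
    because the projections on bounded parts of the spectrum commute with the semigroup and reduce A
    to bounded operators. Time 1 is the base point of the spectral comparison because steps h of
    both signs occur: pi / Im lam has the sign of Im lam. *)

Section RealNorm.
Variable R : realType.

(** The order of [R[i]] is partial; estimates are run on the real part of the norm so that total
    order and [lra] apply. *)
Definition nm (V : normedZmodType R[i]) (x : V) : R := complex.Re `|x|.

Section Zmod.
Variable V : normedZmodType R[i].
Implicit Types x y : V.

Lemma nmE x : `|x| = (nm x)%:C.
Proof. by rewrite RRe_real ?normr_real. Qed.

Lemma nm_ge0 x : 0 <= nm x.
Proof. by rewrite -ler0c -nmE. Qed.

Lemma nm0 : nm (0 : V) = 0.
Proof. by rewrite /nm normr0. Qed.

Lemma nm0_eq0 x : nm x = 0 -> x = 0.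
Proof. by move=> x0; apply/normr0_eq0; rewrite nmE x0. Qed.

Lemma nm_gt0 x : (0 < nm x) = (x != 0).
Proof. by rewrite -normr_gt0 nmE ltcR. Qed.

Lemma nmD x y : nm (x + y) <= nm x + nm y.
Proof. by rewrite -lecR rmorphD /= -!nmE ler_normD. Qed.

Lemma nmN x : nm (- x) = nm x.
Proof. by rewrite /nm normrN. Qed.

Lemma nmB x y : nm (x - y) <= nm x + nm y.
Proof. by rewrite -[nm y]nmN nmD. Qed.

Lemma nm_distC x y : nm (x - y) = nm (y - x).
Proof. by rewrite -nmN opprB. Qed.

Lemma nm_trans z x y : nm (x - y) <= nm (x - z) + nm (z - y).
Proof. by rewrite -[x - y](subrKA z) nmD. Qed.

Lemma nm_lerB x y : nm x - nm y <= nm (x - y).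
Proof. by rewrite lerBlDr; have := nmD (x - y) y; rewrite subrK. Qed.

Lemma nm_le_eq0 x : (forall e : R, 0 < e -> nm x <= e) -> x = 0.
Proof.
move=> xe; apply: nm0_eq0; apply/eqP; rewrite eq_le nm_ge0 andbT.
by apply/ler_addgt0Pl => e e0; rewrite addr0 xe.
Qed.

End Zmod.

Lemma nmZ (V : normedModType R[i]) (a : R[i]) (x : V) :
  nm (a *: x) = nm a * nm x.
Proof. by apply: complexI; rewrite rmorphM /= -!nmE normrZ. Qed.

Lemma nmM (a b : R[i]) : nm (a * b) = nm a * nm b.
Proof. by apply: complexI; rewrite rmorphM /= -!nmE normrM. Qed.

Lemma nmV (a : R[i]) : nm a^-1 = (nm a)^-1.
Proof. by apply: complexI; rewrite fmorphV -!nmE normfV. Qed.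

Lemma nm1 : nm (1 : R[i]) = 1.
Proof. by rewrite /nm normr1. Qed.

Lemma nmR (r : R) : nm r%:C = `|r|.
Proof. by rewrite /nm normc_def /= expr0n addr0 sqrtr_sqr. Qed.

Lemma nm_le_ReIm (z : R[i]) : nm z <= `|complex.Re z| + `|complex.Im z|.
Proof.
have -> : z = (complex.Re z)%:C + 'i%C * (complex.Im z)%:C by exact: complexE.
apply: le_trans (nmD _ _) _; rewrite nmM !nmR.
have -> : nm ('i%C : R[i]) = 1.
  by rewrite /nm normc_def /= expr0n add0r expr1n sqrtr1.
rewrite mul1r /=; case: z => a b /=.
by rewrite !(mul0r, mul1r, mulr0, add0r, addr0, subr0, oppr0).
Qed.

Lemma nm_ge_Re (z : R[i]) : `|complex.Re z| <= nm z.
Proof. by rewrite -lecR -nmE normc_ge_Re. Qed.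

Lemma nm_ge_Im (z : R[i]) : `|complex.Im z| <= nm z.
Proof.
rewrite /nm normc_def /= -sqrtr_sqr ler_wsqrtr //.
by rewrite lerDr sqr_ge0.
Qed.

Section Convergence.
Variable V : normedModType R[i].

Lemma cvg_nmP {T : Type} {F : set_system T} {FF : Filter F} (f : T -> V) (l : V) :
  f @ F --> l <-> forall e : R, 0 < e -> \forall x \near F, nm (l - f x) <= e.
Proof.
split=> [/cvgrPdist_le fl e e0|fl].
  have e0' : (0 : R[i]) < e%:C by rewrite ltcR.
  by apply: filterS (fl _ e0') => x; rewrite nmE lecR.
(* A positive element of [R[i]] has zero imaginary part, so complex tolerances reduce to real
   ones. *)
apply/cvgrPdist_le => -[e e'] /=; rewrite ltcE /= => /andP[/eqP -> e0].
by apply: filterS (fl _ e0) => x; rewrite nmE complexr0 lecR.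
Qed.

Lemma nm_near (x : V) (e : R) : 0 < e -> \forall y \near x, nm (x - y) <= e.
Proof. by move: e; apply/cvg_nmP; apply: cvg_id. Qed.

Lemma cvgn_nmP (u : nat -> V) (l : V) :
  u @ \oo --> l <->
  forall e : R, 0 < e -> exists N, forall n, (N <= n)%N -> nm (l - u n) <= e.
Proof.
rewrite cvg_nmP; split=> ul e /ul.
  by case=> N _ uN; exists N.
by case=> N uN; exists N.
Qed.

Lemma cvg_nm_unique {T : Type} {F : set_system T} {FF : ProperFilter F}
  (f : T -> V) (l l' : V) : f @ F --> l -> f @ F --> l' -> l = l'.
Proof. by apply: cvg_unique. Qed.

Lemma nm_le_lim (u : nat -> V) (l y : V) (C : R) :
  u @ \oo --> l -> (forall n, nm (u n - y) <= C) -> nm (l - y) <= C.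
Proof.
move=> /cvgn_nmP ul uC; apply/ler_addgt0Pr => e /ul[N /(_ _ (leqnn N)) uN].
by apply: le_trans (nm_trans (u N) _ _) _; rewrite addrC lerD.
Qed.

End Convergence.

Lemma cauchy_nm (X : completeNormedModType R[i]) (u : nat -> X) :
  (forall e : R, 0 < e -> exists N, forall m n, (N <= m)%N -> (N <= n)%N ->
    nm (u m - u n) <= e) -> exists l : X, u @ \oo --> l.
Proof.
move=> cu; exists (lim (u @ \oo)); apply: cauchy_cvg.
apply: cauchy_exP => -[e e']; rewrite ltcE /= => /andP[/eqP -> e0].
have /cu[N uN] : 0 < e / 2 by rewrite divr_gt0.
exists (u N); exists N => // n /= Nn.
rewrite -ball_normE /ball_ /= nmE complexr0 ltcR.
by apply: le_lt_trans (uN _ _ (leqnn N) Nn) _; rewrite ltr_pdivrMr // ltr_pMr // ltr1n.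
Qed.

End RealNorm.

(** * Bounded operators and the operator norm *)

Section BoundedOperators.
Variables (R : realType) (X : completeNormedModType R[i]).
Implicit Types (T S : X -> X) (f g : X).

Section Linear.
Variable T : X -> X.
Hypothesis linT : linear T.

Lemma lin0 : T 0 = 0.
Proof. by have := linT (-1) 0 0; rewrite scaler0 addr0 scaleN1r addNr. Qed.

Lemma linD f g : T (f + g) = T f + T g.
Proof. by rewrite -[f in LHS]scale1r linT scale1r. Qed.

Lemma linZ a f : T (a *: f) = a *: T f.
Proof. by rewrite -[a *: f]addr0 linT lin0 addr0. Qed.

Lemma linN f : T (- f) = - T f.
Proof. by rewrite -scaleN1r linZ scaleN1r. Qed.

Lemma linB f g : T (f - g) = T f - T g.
Proof. by rewrite linD linN. Qed.

Lemma lin_sum (I : Type) (r : seq I) (P : pred I) (F : I -> X) :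
  T (\sum_(i <- r | P i) F i) = \sum_(i <- r | P i) T (F i).
Proof. exact: (big_morph T linD lin0). Qed.

End Linear.

Lemma bounded_operatorP T :
  bounded_operator T <->
  linear T /\ exists2 C : R, 0 <= C & forall f, nm (T f) <= C * nm f.
Proof.
split=> [[linT cT]|[linT [C C0 TC]]]; split => //.
  have /cvg_nmP /(_ 1 ltr01) := cT 0.
  rewrite (lin0 linT) => /nbhs_ballP[] [e e'] /=.
  rewrite ltcE /= => /andP[/eqP -> e0] eT.
  exists (2 / e) => [|f]; first by rewrite divr_ge0 ?ltW.
  have [->|f0] := eqVneq f 0; first by rewrite (lin0 linT) !nm0 mulr0.
  have nf : 0 < nm f by rewrite nm_gt0.
  (* Halving [e] keeps the rescaled vector strictly inside the ball on which [T] is bounded by 1. *)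
  set c := e / 2 / nm f; have c0 : 0 < c by rewrite !divr_gt0.
  have : nm (T (c%:C *: f)) <= 1.
    rewrite -nmN -sub0r; apply: eT.
    rewrite -ball_normE /ball_ /= sub0r normrN nmE complexr0 ltcR.
    rewrite nmZ nmR gtr0_norm // divfK ?gt_eqF //.
    by rewrite ltr_pdivrMr // ltr_pMr // ltr1n.
  rewrite (linZ linT) nmZ nmR gtr0_norm //.
  have -> : c * nm (T f) = nm (T f) / (2 / e * nm f).
    by rewrite /c; field; rewrite !gt_eqF.
  by rewrite ler_pdivrMr ?mul1r // mulr_gt0 // divr_gt0.
move=> f; apply/cvg_nmP => e e0; have C1 : 0 < C + 1 by rewrite ltr_wpDl.
near=> g.
rewrite -(linB linT); apply: le_trans (TC _) _.
have : nm (f - g) <= e / (C + 1).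
  by near: g; apply: nm_near; rewrite divr_gt0.
rewrite ler_pdivlMr //; apply: le_trans.
by rewrite mulrC ler_wpM2l ?nm_ge0 // lerDl.
Unshelve. all: by end_near. Qed.

Lemma bounded_lin T : bounded_operator T -> linear T.
Proof. by case. Qed.

(** [sup] takes a default value on sets without an upper bound, so each use of [opnorm] rests on
    this finiteness. *)
Lemma opnorm_has_sup T : bounded_operator T ->
  has_sup [set complex.Re `|T f| | f in [set f : X | `|f| <= 1]].
Proof.
move=> /bounded_operatorP[linT [C C0 TC]]; split.
  by exists (complex.Re `|T 0|); exists 0 => //=; rewrite normr0 ler01.
exists C => _ [f /= f1 <-]; apply: le_trans (TC f) _.
by rewrite ler_piMr // -lecR -nmE.
Qed.

Lemma opnorm_ge0 T : bounded_operator T -> 0 <= opnorm T.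
Proof.
move=> bT; have [_ ubT] := opnorm_has_sup bT.
apply: (ub_le_sup ubT); exists 0 => /=; first by rewrite normr0 ler01.
by rewrite (lin0 (bounded_lin bT)) normr0.
Qed.

Lemma nm_le_opnorm T f : bounded_operator T -> nm (T f) <= opnorm T * nm f.
Proof.
move=> bT; have [_ ubT] := opnorm_has_sup bT; have linT := bounded_lin bT.
have [->|f0] := eqVneq f 0; first by rewrite (lin0 linT) !nm0 mulr0.
have nf : 0 < nm f by rewrite nm_gt0.
rewrite -ler_pdivrMr //; apply: (ub_le_sup ubT).
exists ((nm f)^-1%:C *: f) => /=.
  by rewrite normrZ !nmE nmR -rmorphM /= gtr0_norm ?invr_gt0 // mulVf ?gt_eqF.
by rewrite (linZ linT) -/(nm _) nmZ nmR gtr0_norm ?invr_gt0 // mulrC.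
Qed.

Lemma opnorm_le T (C : R) : bounded_operator T -> 0 <= C ->
  (forall f, nm (T f) <= C * nm f) -> opnorm T <= C.
Proof.
move=> bT C0 TC; apply: ge_sup; first by have [] := opnorm_has_sup bT.
move=> _ [f /= f1 <-]; apply: le_trans (TC f) _.
by rewrite ler_piMr // -lecR -nmE.
Qed.

Lemma bounded_operatorB T S : bounded_operator T -> bounded_operator S ->
  bounded_operator (fun f => T f - S f).
Proof.
move=> [lT cT] [lS cS]; split=> [a f g|f] /=.
  by rewrite lS lT scalerBr opprD addrACA.
by apply: cvgB; [apply: cT|apply: cS].
Qed.

Lemma bounded_operator_cvg T (I : Type) (F : set_system I) (FF : Filter F)
    (u : I -> X) (l : X) :
  bounded_operator T -> u @ F --> l -> T (u i) @[i --> F] --> T l.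
Proof. by move=> [_ cT] ul; apply: cvg_comp ul (cT l). Qed.

End BoundedOperators.

(** * The Banach-Steinhaus theorem *)

Section UniformBoundedness.
Variables (R : realType) (X : completeNormedModType R[i]).

(** With ratio 3 the steps after the n-th add up to at most [r n / 2]. Of a gain [2 / 3 * (N * r n)]
    made at step n, at least [N * r n / 6] then survives in the limit; the operator of step n is
    chosen so that this is at least n. *)
Let r (n : nat) : R := (3 ^+ n)^-1.

Let r_gt0 n : 0 < r n.
Proof. by rewrite invr_gt0 exprn_gt0. Qed.

Let rS n : r n.+1 = r n / 3.
Proof. by rewrite /r exprS invfM mulrC. Qed.

Let r_small (e : R) : 0 < e -> exists n, r n <= e.
Proof.
move=> e0; have [n] := ltr_add_invr e0; rewrite add0r => ne.
exists n; apply: le_trans (ltW ne).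
rewrite lef_pV2 ?posrE ?exprn_gt0 // -natrX ler_nat.
exact: ltn_expl.
Qed.

(* Sokal's proof: starting from any x, a step of length r n in the direction
   nearly maximizing the n-th operator, with the right sign, makes the image
   large, and the steps that follow are too short to undo this. *)
Lemma uniform_boundedness (I : Type) (T : I -> X -> X) :
  (forall i, bounded_operator (T i)) ->
  (forall f, exists C : R, forall i, nm (T i f) <= C) ->
  exists2 C : R, 0 <= C & forall i f, nm (T i f) <= C * nm f.
Proof.
move=> bT pT; apply: contrapT => noC.
have step n (x : X) : exists p : X * (I * R),
    [/\ nm (p.1 - x) <= r n, forall f, nm (T p.2.1 f) <= p.2.2 * nm f,
        2 / 3 * (p.2.2 * r n) <= nm (T p.2.1 p.1) & n%:R <= p.2.2 * r n / 6].
  have [i [f Tf]] : exists i f, 6 * n.+1%:R / r n * nm f < nm (T i f).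
    apply: contrapT => H; apply: noC; exists (6 * n.+1%:R / r n).
      by rewrite divr_ge0 ?mulr_ge0 // ltW.
    move=> i f; rewrite leNgt; apply/negP => lt; apply: H.
    by exists i, f.
  set N := opnorm (T i).
  have Nge : 6 * n.+1%:R / r n <= N.
    rewrite leNgt; apply/negP => lt; move: Tf; apply/negP; rewrite -leNgt.
    apply: le_trans (nm_le_opnorm _ (bT i)) _.
    by rewrite ler_wpM2r ?nm_ge0 // ltW.
  have N0 : 0 < N by apply: lt_le_trans Nge; rewrite divr_gt0 // mulr_gt0.
  have [g Tg] : exists g, 2 / 3 * N * nm g < nm (T i g).
    apply: contrapT => H.
    have : N <= 2 / 3 * N.
      apply: opnorm_le => //; first by rewrite mulr_ge0 // ltW.
      move=> g; rewrite leNgt; apply/negP => lt; apply: H.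
      by exists g.
    lra.
  have linT := bounded_lin (bT i).
  have g0 : 0 < nm g.
    rewrite nm_gt0; apply/eqP => g0; move: Tg.
    by rewrite g0 (lin0 linT) !nm0 mulr0 ltxx.
  pose h := (r n / nm g)%:C *: g.
  have nh : nm h = r n.
    by rewrite nmZ nmR gtr0_norm ?divr_gt0 // divfK // gt_eqF.
  have Th : 2 / 3 * (N * r n) <= nm (T i h).
    rewrite (linZ linT) nmZ nmR gtr0_norm ?divr_gt0 //.
    have -> : 2 / 3 * (N * r n) = r n / nm g * (2 / 3 * N * nm g).
      by field; rewrite gt_eqF.
    by rewrite ler_pM2l ?divr_gt0 // ltW.
  have nN : n%:R <= N * r n / 6.
    have := Nge; rewrite ler_pdivrMr // => le.
    rewrite ler_pdivlMr // mulrC; apply: le_trans le.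
    by rewrite ler_pM2l // ler_nat.
  (* The images of [x + h] and [x - h] differ by twice the image of [h], so one of them has norm at
     least that of [T i h]. *)
  have [le|lt] := lerP (nm (T i h)) (nm (T i (x + h))).
    exists (x + h, (i, N)); split => //=; first by rewrite addrAC subrr add0r nh.
      by move=> ?; apply: nm_le_opnorm.
    exact: le_trans le.
  exists (x - h, (i, N)); split => //=.
  - by rewrite addrAC subrr add0r nmN nh.
  - by move=> ?; apply: nm_le_opnorm.
  - apply: (le_trans Th).
    have := nmB (T i (x + h)) (T i (x - h)).
    have -> : T i (x + h) - T i (x - h) = 2%:R *: T i h.
      by rewrite -(linB linT) -(linZ linT) opprB addrC addrA subrK scaler_nat.
    rewrite nmZ -(rmorph_nat (real_complex R)) nmR (ger0_norm (ler0n _ _)); lra.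
have {step} [s sP] : {s : nat -> X -> X * (I * R) | forall n x,
    [/\ nm ((s n x).1 - x) <= r n,
        forall f, nm (T (s n x).2.1 f) <= (s n x).2.2 * nm f,
        2 / 3 * ((s n x).2.2 * r n) <= nm (T (s n x).2.1 (s n x).1) &
        n%:R <= (s n x).2.2 * r n / 6]}.
  have /choice := fun nx : nat * X => step nx.1 nx.2.
  move=> [s sP]; exists (fun n x => s (n, x)) => n x.
  exact: sP (n, x).
pose x := fix x n := if n is m.+1 then (s m (x m)).1 else 0.
have xk n k : nm (x (n.+1 + k)%N - x n.+1) <= (r n - r (n + k)%N) / 2.
  elim: k => [|k IHk]; first by rewrite !addn0 !subrr nm0 mul0r.
  apply: le_trans (nm_trans (x (n.+1 + k)%N) _ _) _.
  rewrite [in X in X + _]addnS; have [le _ _ _] := sP (n.+1 + k)%N (x (n.+1 + k)%N).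
  have := le_trans (lerD le IHk) _; apply.
  by rewrite addSn addnS rS; have := r_gt0 (n + k)%N; lra.
have xm n m : (n < m)%N -> nm (x m - x n.+1) <= r n / 2.
  move=> nm; rewrite -(subnKC nm); apply: le_trans (xk _ _) _.
  by have := r_gt0 (n + (m - n.+1))%N; lra.
have [l xl] : exists l : X, x @ \oo --> l.
  apply: cauchy_nm => e /r_small[N Ne].
  exists N.+1 => m n Nm Nn; apply: le_trans (nm_trans (x N.+1) _ _) _.
  rewrite [nm (_ - x n)]nm_distC.
  by apply: le_trans (lerD (xm _ _ Nm) (xm _ _ Nn)) _; lra.
have xl_le n : nm (l - x n.+1) <= r n / 2.
  apply: (@nm_le_lim _ _ (fun k => x (n.+1 + k)%N)) => [|k].
    by rewrite (_ : (fun _ => _) = x \o addn n.+1) //; apply: cvg_comp xl;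
      apply: cvg_addnl.
  by apply: xm; rewrite addSn ltnS leq_addr.
have [C TC] := pT l.
have [_ Tb Tx nN] := sP (Num.truncn C).+1 (x (Num.truncn C).+1).
set n := (Num.truncn C).+1 in Tb Tx nN.
set i := (s n (x n)).2.1 in Tb Tx; set N := (s n (x n)).2.2 in Tb Tx nN.
have : nm (T i l) <= C by [].
have : C < n%:R by rewrite truncnS_gt.
have := nm_lerB (T i (x n.+1)) (T i l).
rewrite -(linB (bounded_lin (bT i))) => le1 ltC leC.
have N0 : 0 <= N.
  have : 0 <= N * r n by rewrite -(@pmulr_lge0 _ (6^-1)) // (le_trans _ nN).
  by rewrite pmulr_lge0.
have le2 := le_trans (Tb (x n.+1 - l)) (ler_wpM2l N0 _).
have {le2} := le2 (r n / 2); rewrite nm_distC => /(_ (xl_le n)).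
move: Tx; rewrite -/(x n.+1) => Tx le2.
lra.
Qed.

End UniformBoundedness.

(** * Boundedness of spectral measures *)

Section Borel.
Variable R : realType.
Implicit Types A B : set R[i].

Lemma borel_open A : open A -> borel A.
Proof. exact: sub_sigma_algebra. Qed.

Lemma borelC A : borel A -> borel (~` A).
Proof. exact: (@measurableC _ (g_sigma_algebraType (@open R[i]))). Qed.

Lemma borel_closed A : closed A -> borel A.
Proof.
move=> cA; rewrite -[A]setCK; apply: borelC; apply: borel_open.
exact: closed_openC.
Qed.

Lemma borelT : borel (@setT R[i]).
Proof. by apply: borel_open; apply: openT. Qed.

Lemma borel0 : borel (@set0 R[i]).
Proof. by apply: borel_open; apply: open0. Qed.

Lemma borelU A B : borel A -> borel B -> borel (A `|` B).
Proof. exact: (@measurableU _ (g_sigma_algebraType (@open R[i]))). Qed.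

Lemma borelI A B : borel A -> borel B -> borel (A `&` B).
Proof. exact: (@measurableI _ (g_sigma_algebraType (@open R[i]))). Qed.

Lemma borelD A B : borel A -> borel B -> borel (A `\` B).
Proof. exact: (@measurableD _ (g_sigma_algebraType (@open R[i]))). Qed.

Lemma borel_bigcup (F : nat -> set R[i]) :
  (forall n, borel (F n)) -> borel (\bigcup_n F n).
Proof.
by move=> bF; apply: (@bigcupT_measurable _ (g_sigma_algebraType (@open R[i]))).
Qed.

(** Sets with Borel preimage form a sigma-algebra containing the open sets; applying [bA] is the
    minimality of [borel]. *)
Lemma borel_preimage (h : R[i] -> R[i]) :
  (forall U, open U -> borel (h @^-1` U)) -> forall A, borel A -> borel (h @^-1` A).
Proof.
move=> hU A bA; apply: (bA [set B | borel (h @^-1` B)]); split; last exact: hU.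
split.
- by rewrite /= preimage_set0; apply: borel0.
- by move=> B bB; rewrite /= setTD preimage_setC; apply: borelC.
- by move=> F bF; rewrite /= preimage_bigcup; apply: borel_bigcup.
Qed.

(** With [T] finite, such a [p] encodes a finite Borel partition of the plane labelled by [T], and
    pairing two maps gives the common refinement. *)
Definition borel_fibers (T : Type) (p : R[i] -> T) :=
  forall t, borel (p @^-1` [set t]).

Lemma borel_fibers_pred (T : finType) (p : R[i] -> T) (P : pred T) :
  borel_fibers p -> borel [set z | P (p z)].
Proof.
move=> bp; suff : borel [set z | p z \in enum P].
  by congr borel; apply/seteqP; split=> z /=; rewrite mem_enum.
elim: (enum P) => [|t r IHr].
  have -> : [set z | p z \in [::]] = set0 by apply/seteqP; split.
  by apply: borel0.
have -> : [set z | p z \in t :: r] = p @^-1` [set t] `|` [set z | p z \in r].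
  apply/seteqP; split=> z /=; rewrite inE.
    by case/orP => [/eqP|]; [left|right].
  by case=> [->|->]; rewrite ?eqxx ?orbT.
by apply: borelU.
Qed.

Lemma borel_fibers_pair (T U : Type) (p : R[i] -> T) (q : R[i] -> U) :
  borel_fibers p -> borel_fibers q -> borel_fibers (fun z => (p z, q z)).
Proof.
move=> bp bq [t u]; have := borelI (bp t) (bq u); congr borel.
by apply/seteqP; split=> z /= [-> ->].
Qed.

Lemma borel_fibers_ind A : borel A -> borel_fibers (fun z => `[< A z >]).
Proof.
move=> bA [|]; [have := bA|have := borelC bA]; congr borel.
  by apply/seteqP; split=> z /=; move/asboolP.
by apply/seteqP; split=> z /=; case: asboolP.
Qed.

End Borel.

(** * Finite additivity and uniform boundedness of a spectral measure *)

Section SpectralMeasureTheory.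
Variables (R : realType) (X : completeNormedModType R[i]).
Variable E : set R[i] -> X -> X.
Hypothesis hE : spectral_measure E.
Implicit Types (A B : set R[i]) (f g : X).

Lemma spectral_lin A : borel A -> linear (E A).
Proof. by move=> bA; apply: bounded_lin; apply: spectral_bounded hE _ bA. Qed.

Lemma spectral_setU A B f : borel A -> borel B -> A `&` B = set0 ->
  E (A `|` B) f = E A f + E B f.
Proof.
move=> bA bB AB0.
have bF n : borel (bigcup2 A B n) by case: n => [|[|n]] //=; apply: borel0.
have tF : trivIset setT (bigcup2 A B) by rewrite -trivIset_bigcup2.
have := @spectral_sigma_additive _ _ _ hE _ bF tF f; rewrite bigcup2E => lim1.
apply: (cvg_nm_unique lim1); apply/cvgn_nmP => e e0; exists 2%N => n n2.
rewrite (@big_cat_nat _ _ _ 2) //= big_nat_recl // big_nat1 /=.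
rewrite big_nat_cond big1 ?addr0 ?subrr ?nm0 ?ltW // => k.
by rewrite andbT => /andP[]; case: k => [|[|k]] // _ _; rewrite /= (spectral_set0 hE).
Qed.

Lemma spectral_setD A B f : borel A -> borel B -> B `<=` A ->
  E (A `\` B) f = E A f - E B f.
Proof.
move=> bA bB BA; have bD := borelD bA bB.
rewrite -{2}(setDUK BA) spectral_setU // ?setDIK //.
by rewrite addrAC subrr add0r.
Qed.

Lemma spectral_setIA A B f : borel A -> borel B -> E (A `&` B) f = E A (E B f).
Proof. by move=> bA bB; rewrite (spectral_setI hE). Qed.

Lemma spectral_sum (T : finType) (p : R[i] -> T) (P : pred T) A f :
  borel_fibers p -> borel A ->
  \sum_(t | P t) E (A `&` p @^-1` [set t]) f = E (A `&` [set z | P (p z)]) f.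
Proof.
move=> bp bA; rewrite -big_filter.
have : uniq [seq t <- index_enum T | P t] by rewrite filter_uniq ?index_enum_uniq.
have -> : [set z | P (p z)] = [set z | p z \in [seq t <- index_enum T | P t]].
  by apply/seteqP; split=> z /=; rewrite mem_filter mem_index_enum andbT.
elim: [seq t <- index_enum T | P t] => [|t r IHr] /=.
  rewrite big_nil => _; have -> : [set z | p z \in [::]] = set0.
    by apply/seteqP; split.
  by rewrite setI0 (spectral_set0 hE).
move=> /andP[tr ur]; rewrite big_cons IHr // -spectral_setU.
- congr (E _ f); rewrite -setIUr; congr (_ `&` _); apply/seteqP; split=> z /=.
    by rewrite inE => -[->|->]; rewrite ?eqxx ?orbT.
  by rewrite inE => /orP[/eqP|]; [left|right].
- exact: borelI.
- apply: borelI => //; exact: (borel_fibers_pred (mem r)).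
- by apply/seteqP; split=> z //= -[[_ pzt] [_]]; rewrite pzt (negPf tr).
Qed.

(* A set over which nm (E _ f) is unbounded splits into a set with nm (E _ f)
   at least 1 and a set over which it is again unbounded.  Iterating this gives
   disjoint sets that contradict sigma-additivity. *)
Lemma spectral_bounded_at f : exists C : R, forall A, borel A -> nm (E A f) <= C.
Proof.
apply: contrapT => noC.
pose bad A := borel A /\
  forall C : R, exists B, [/\ B `<=` A, borel B & C < nm (E B f)].
have badT : bad setT.
  split=> [|C]; first exact: borelT.
  apply: contrapT => H; apply: noC; exists C => A bA; rewrite leNgt.
  by apply/negP => lt; apply: H; exists A.
have step A : exists p : set R[i] * set R[i], bad A ->
    [/\ p.1 `<=` A, p.2 `<=` A, p.1 `&` p.2 = set0, borel p.1 /\ 1 <= nm (E p.1 f)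
      & bad p.2].
  have [[bA badA]|nbad] := pselect (bad A); last by exists (A, A).
  have [B [BA bB ltB]] := badA (1 + nm (E A f)).
  have bD := borelD bA bB.
  have ltD : 1 <= nm (E (A `\` B) f).
    rewrite spectral_setD // nm_distC; apply: le_trans (nm_lerB _ _).
    by rewrite lerBrDr ltW.
  have ltB' : 1 <= nm (E B f) by rewrite ltW // (le_lt_trans _ ltB) // lerDl nm_ge0.
  have [badB|nbadB] := pselect (bad B).
    by exists (A `\` B, B) => _; split=> //; [apply: subDsetl|apply: setDKI].
  have [badD|nbadD] := pselect (bad (A `\` B)).
    by exists (B, A `\` B) => _; split=> //; [apply: subDsetl|apply: setDIK].
  exfalso.
  (* If neither half were bad, the bounds on the subsets of each would add up to a bound on the
     subsets of [A]. *)
  have bnd A' : borel A' -> ~ bad A' ->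
      exists C : R, forall B, B `<=` A' -> borel B -> nm (E B f) <= C.
    move=> bA' nb; apply: contrapT => H; apply: nb; split=> // C.
    apply: contrapT => H'; apply: H; exists C => B' B'A bB'; rewrite leNgt.
    by apply/negP => lt; apply: H'; exists B'.
  have [C1 C1P] := bnd _ bB nbadB; have [C2 C2P] := bnd _ bD nbadD.
  have [B' [B'A bB']] := badA (C1 + C2); apply/negP; rewrite -leNgt.
  have -> : B' = (B' `&` B) `|` (B' `\` B) by rewrite setUIDK.
  rewrite spectral_setU; [|exact: borelI|exact: borelD|]; last first.
    by apply/seteqP; split=> z //= [[_ ?] []].
  apply: le_trans (nmD _ _) _; apply: lerD.
    by apply: C1P; [apply: subIsetr|apply: borelI].
  by apply: C2P; [move=> z [/B'A]; split|apply: borelD].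
have [s sP] := choice step.
pose D := fix D n := if n is m.+1 then (s (D m)).2 else setT.
have badD n : bad (D n).
  by elim: n => [|n IHn] //=; have [] := sP _ IHn.
have D_ge m n : (m <= n)%N -> D n `<=` D m.
  move=> /subnKC <-; elim: (n - m)%N => [|k IHk]; first by rewrite addn0.
  by rewrite addnS /=; apply: subset_trans IHk; have [] := sP _ (badD (m + k)%N).
pose d n := (s (D n)).1.
have bd n : borel (d n) by have [_ _ _ []] := sP _ (badD n).
have dD0 m n : (m < n)%N -> d m `&` d n = set0.
  move=> mn; apply/seteqP; split=> // z [zm zn].
  have [_ _ <- _ _] := sP _ (badD m); split => //.
  apply: (D_ge _ _ mn); have [dn _ _ _ _] := sP _ (badD n).
  exact: dn.
have td : trivIset setT d.
  apply/trivIsetP => i j _ _; rewrite neq_ltn => /orP[/dD0//|/dD0].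
  by rewrite setIC.
(* Two consecutive partial sums within 1/4 of the limit are within 1/2 of each other, yet they
   differ by a term of norm at least 1. *)
have /cvgn_nmP /(_ (4^-1)) := @spectral_sigma_additive _ _ _ hE _ bd td f.
move=> /(_ _)[|N NP]; first by rewrite invr_gt0.
have := nm_trans (E (\bigcup_n d n) f) (\sum_(0 <= k < N.+1) E (d k) f)
  (\sum_(0 <= k < N) E (d k) f).
rewrite big_nat_recr //= addrAC subrr add0r nm_distC.
have := NP N.+1 (leqnSn N); rewrite big_nat_recr //=.
have := NP N (leqnn N); have [_ _ _ [_ + _]] := sP _ (badD N); rewrite -/(d N); lra.
Qed.

Lemma spectral_uniformly_bounded :
  exists2 M : R, 0 <= M & forall A f, borel A -> nm (E A f) <= M * nm f.
Proof.
have [||M M0 HM] := @uniform_boundedness R X {A | borel A} (fun b => E (sval b)).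
- by move=> [A bA]; apply: spectral_bounded hE _ bA.
- move=> f; have [C HC] := spectral_bounded_at f.
  by exists C => -[A bA]; apply: HC.
by exists M => // A f bA; apply: (HM (exist _ A bA)).
Qed.

End SpectralMeasureTheory.

(** * Functional calculus for bounded Borel functions *)

(* The norm is convex in each coefficient, hence largest at a vertex of the
   cube. *)
Lemma convex_sum_le (R : realType) (V : normedModType R[i]) (I : eqType)
    (r : seq I) (y : I -> V) (x : V) (M : R) :
  uniq r -> (forall P : pred I, nm (x + \sum_(i <- r | P i) y i) <= M) ->
  forall c : I -> R, (forall i, 0 <= c i <= 1) ->
  nm (x + \sum_(i <- r) (c i)%:C *: y i) <= M.
Proof.
elim: r x => [|i r IHr] x /=.
  by move=> _ /(_ predT) + c _; rewrite !big_nil.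
move=> /andP[ir ur] leM c c01; have /andP[ci0 ci1] := c01 i.
have eqS (P : pred I) b : \sum_(j <- i :: r | if j == i then b else P j) y j =
    (if b then y i else 0) + \sum_(j <- r | P j) y j.
  rewrite big_cons eqxx.
  have -> : \sum_(j <- r | if j == i then b else P j) y j = \sum_(j <- r | P j) y j.
    rewrite big_seq_cond [RHS]big_seq_cond; apply: eq_bigl => j.
    by case: eqP => // ->; rewrite (negPf ir).
  by case: b => //; rewrite add0r.
have le0 : nm (x + \sum_(j <- r) (c j)%:C *: y j) <= M.
  apply: IHr => // P; have := leM (fun j => if j == i then false else P j).
  by rewrite eqS add0r.
have le1 : nm (x + y i + \sum_(j <- r) (c j)%:C *: y j) <= M.
  apply: IHr => // P; have := leM (fun j => if j == i then true else P j).
  by rewrite eqS addrA.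
rewrite big_cons; set s := \sum_(j <- r) _ in le0 le1 *.
have -> : x + ((c i)%:C *: y i + s) =
    (1 - c i)%:C *: (x + s) + (c i)%:C *: (x + y i + s).
  rewrite rmorphB /= scalerBl scale1r -[x + y i + s]addrAC.
  by rewrite (scalerDr _ (x + s)) [RHS]addrA subrK addrA addrAC.
apply: le_trans (nmD _ _) _; rewrite !nmZ !nmR !ger0_norm ?subr_ge0 //.
apply: le_trans (lerD (ler_wpM2l _ le0) (ler_wpM2l _ le1)) _ => //.
  by rewrite subr_ge0.
by rewrite -mulrDl subrK mul1r.
Qed.

Section SimpleCalculus.
Variables (R : realType) (X : completeNormedModType R[i]).
Variable E : set R[i] -> X -> X.
Hypothesis hE : spectral_measure E.

(** The integral of [c \o p]. Labels that [p] never takes contribute nothing, their fibre being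
    empty. *)
Definition simple_op (T : finType) (p : R[i] -> T) (c : T -> R[i]) (f : X) : X :=
  \sum_t c t *: E (p @^-1` [set t]) f.

Lemma simple_op_lin T p c : borel_fibers p -> linear (@simple_op T p c).
Proof.
move=> bp a f g; rewrite scaler_sumr -big_split /=; apply: eq_bigr => t _.
by rewrite (spectral_lin hE (bp t)) scalerDr !scalerA mulrC.
Qed.

(** The affine map [v] sends [-B, B] onto [0, 1], and [c = 2 * B * v - B]. Convexity bounds the [v]
    part by [M * nm f], and the constant part is [B] times the identity, whence the factor
    [2 * M + 1]. *)
Let simple_op_real_bound : exists2 M : R, 0 <= M &
  forall (T : finType) (p : R[i] -> T) (c : T -> R) (B : R) f,
    borel_fibers p -> 0 < B -> (forall t, `|c t| <= B) ->
    nm (simple_op p (fun t => (c t)%:C) f) <= M * B * nm f.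
Proof.
have [M M0 EM] := spectral_uniformly_bounded hE.
exists (2 * M + 1) => [|T p c B f bp B0 cB]; first by lra.
pose v t := (c t + B) / (2 * B).
have v01 t : 0 <= v t <= 1.
  have := cB t; rewrite ler_norml => /andP[c1 c2].
  by rewrite divr_ge0 /= ?ler_pdivrMr; lra.
have sumE (P : pred T) :
    \sum_(t | P t) E (p @^-1` [set t]) f = E [set z | P (p z)] f.
  have := spectral_sum hE P f bp (@borelT R); rewrite setTI => <-.
  by apply: eq_bigr => t _; rewrite setTI.
have v_le : nm (0 + \sum_t (v t)%:C *: E (p @^-1` [set t]) f) <= M * nm f.
  apply: convex_sum_le => //; first exact: index_enum_uniq.
  by move=> P; rewrite add0r sumE; apply: EM; apply: borel_fibers_pred.
have -> : simple_op p (fun t => (c t)%:C) f =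
    (2 * B)%:C *: (0 + \sum_t (v t)%:C *: E (p @^-1` [set t]) f) - B%:C *: f.
  have fE : f = \sum_t E (p @^-1` [set t]) f.
    rewrite sumE; have -> : [set z | predT (p z)] = setT by apply/seteqP.
    by rewrite (spectral_setT hE).
  rewrite {3}fE add0r !scaler_sumr -sumrB; apply: eq_bigr => t _.
  rewrite scalerA -scalerBl -rmorphM -rmorphB; congr (_%:C *: _).
  by rewrite /v; field; rewrite gt_eqF.
apply: le_trans (nmB _ _) _; rewrite !nmZ !nmR !gtr0_norm ?mulr_gt0 //.
have B2 : 0 <= 2 * B by lra.
by have := ler_wpM2l B2 v_le; lra.
Qed.

(** Real and imaginary parts each cost the real constant [M]; adding 1 makes [K] positive. The
    coefficients are bounded only at values taken by [p], which is what a uniform bound on a symbol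
    supplies. *)
Lemma simple_op_bound : exists2 K : R, 0 < K &
  forall (T : finType) (p : R[i] -> T) (c : T -> R[i]) (B : R) f,
    borel_fibers p -> (forall z, nm (c (p z)) <= B) ->
    nm (simple_op p c f) <= K * B * nm f.
Proof.
have [M M0 EM] := simple_op_real_bound.
exists (2 * M + 1) => [|T p c B f bp cB]; first by lra.
apply/ler_addgt0Pr => e e0.
have B0 : 0 <= B by apply: le_trans (cB 0); apply: nm_ge0.
have Me0 : 0 < (2 * M + 1) * nm f + 1 by rewrite ltr_wpDl // mulr_ge0 ?nm_ge0; lra.
(* The real bound asks for a positive bound, whereas [B] may vanish; the surplus costs at most [e]
   in the end. *)
pose B' := B + e / ((2 * M + 1) * nm f + 1).
have B'0 : 0 < B' by rewrite ltr_wpDl // divr_gt0.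
(* Coefficients at labels outside the range of [p] are uncontrolled, so they are replaced by 0. *)
pose hit t := `[< exists z, p z = t >].
pose a t := if hit t then complex.Re (c t) else 0.
pose b t := if hit t then complex.Im (c t) else 0.
have cB' t : hit t -> nm (c t) <= B'.
  by move=> /asboolP[z <-]; apply: le_trans (cB z) _; rewrite lerDl divr_ge0 // ltW.
have aB t : `|a t| <= B'.
  rewrite /a; case: ifP => [/cB'|_]; last by rewrite normr0 ltW.
  by apply: le_trans; apply: nm_ge_Re.
have bB t : `|b t| <= B'.
  rewrite /b; case: ifP => [/cB'|_]; last by rewrite normr0 ltW.
  by apply: le_trans; apply: nm_ge_Im.
have -> : simple_op p c f = simple_op p (fun t => (a t)%:C) f +
    'i%C *: simple_op p (fun t => (b t)%:C) f.
  rewrite scaler_sumr -big_split /=; apply: eq_bigr => t _.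
  rewrite scalerA -scalerDl /a /b /hit; case: asboolP => [_|nt].
    by rewrite -complexE.
  have -> : p @^-1` [set t] = set0.
    by apply/seteqP; split=> // z pz; apply: nt; exists z.
  by rewrite (spectral_set0 hE) !scaler0.
apply: le_trans (nmD _ _) _; rewrite nmZ.
have -> : nm ('i%C : R[i]) = 1.
  by rewrite /nm normc_def /= expr0n add0r expr1n sqrtr1.
have := EM T p a B' f bp B'0 aB; have := EM T p b B' f bp B'0 bB.
have e' : B' * ((2 * M + 1) * nm f + 1) = B * ((2 * M + 1) * nm f + 1) + e.
  by rewrite /B' mulrDl divfK // gt_eqF.
have : B <= B' by rewrite lerDl divr_ge0 // ltW.
have := nm_ge0 f; nra.
Qed.

(** Differences and products of two simple operators are computed on the common refinement; the next
    two lemmas say that refining leaves each operator unchanged. *)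
Lemma simple_op_pair (T U : finType) (p : R[i] -> T) (q : R[i] -> U)
    (h : T * U -> R[i]) f :
  simple_op (fun z => (p z, q z)) h f =
  \sum_t \sum_u h (t, u) *: E (p @^-1` [set t] `&` q @^-1` [set u]) f.
Proof.
rewrite pair_bigA; apply: eq_bigr => -[t u] _; congr (_ *: E _ f).
by apply/seteqP; split=> z /= [-> ->].
Qed.

Lemma simple_op_refinel (T U : finType) (p : R[i] -> T) (q : R[i] -> U)
    (c : T -> R[i]) f :
  borel_fibers p -> borel_fibers q ->
  simple_op (fun z => (p z, q z)) (fun tu => c tu.1) f = simple_op p c f.
Proof.
move=> bp bq; rewrite simple_op_pair; apply: eq_bigr => t _ /=.
rewrite -scaler_sumr (spectral_sum hE) //; congr (_ *: E _ f).
by apply/seteqP; split=> z //= [].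
Qed.

Lemma simple_op_refiner (T U : finType) (p : R[i] -> T) (q : R[i] -> U)
    (d : U -> R[i]) f :
  borel_fibers p -> borel_fibers q ->
  simple_op (fun z => (p z, q z)) (fun tu => d tu.2) f = simple_op q d f.
Proof.
move=> bp bq; rewrite simple_op_pair exchange_big; apply: eq_bigr => u _ /=.
under eq_bigr do rewrite setIC.
rewrite -scaler_sumr (spectral_sum hE) //; congr (_ *: E _ f).
by apply/seteqP; split=> z //= [].
Qed.

Section TwoSimple.
Variables (T U : finType) (p : R[i] -> T) (q : R[i] -> U).
Variables (c : T -> R[i]) (d : U -> R[i]) (f : X).
Hypotheses (bp : borel_fibers p) (bq : borel_fibers q).
Let pq z := (p z, q z).

Lemma simple_opB : simple_op pq (fun tu => c tu.1 - d tu.2) f =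
  simple_op p c f - simple_op q d f.
Proof.
rewrite -(simple_op_refinel c f bp bq) -(simple_op_refiner d f bp bq).
by rewrite -sumrB; apply: eq_bigr => tu _ /=; rewrite -scalerBl.
Qed.

Lemma simple_opM : simple_op pq (fun tu => c tu.1 * d tu.2) f =
  simple_op p c (simple_op q d f).
Proof.
rewrite simple_op_pair; apply: eq_bigr => t _.
rewrite (lin_sum (spectral_lin hE (bp t))) scaler_sumr.
apply: eq_bigr => u _; rewrite (linZ (spectral_lin hE (bp t))) scalerA.
by rewrite -spectral_setIA.
Qed.

End TwoSimple.

End SimpleCalculus.

Lemma subrACA (V : zmodType) (a b c d : V) : a - b - (c - d) = a - c - (b - d).
Proof.
by rewrite !opprB -!addrA; congr (_ + _); rewrite addrCA [RHS]addrCA [- b - c]addrC.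
Qed.

(** * Uniform limits of simple Borel functions *)

Section TotallyMeasurable.
Variable R : realType.
Implicit Types G H : R[i] -> R[i].

(* G is a uniform limit of functions c \o p, where p has finitely many values
   and Borel fibres. *)
Definition totally_measurable G := forall e : R, 0 < e ->
  exists (T : finType) (p : R[i] -> T) (c : T -> R[i]),
    borel_fibers p /\ forall z, nm (c (p z) - G z) <= e.

Definition indic (A : set R[i]) (z : R[i]) : R[i] := `[< A z >]%:R.

Lemma totally_measurable_bounded G : totally_measurable G ->
  exists B : R, forall z, nm (G z) <= B.
Proof.
move=> /(_ 1 ltr01)[T [p [c [_ cG]]]]; exists (\sum_t nm (c t) + 1) => z.
have := nmB (c (p z)) (c (p z) - G z); rewrite opprB addrC subrK.
move=> /le_trans; apply; apply: lerD => //.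
by rewrite (bigD1 (p z)) //= lerDl sumr_ge0 // => t _; apply: nm_ge0.
Qed.

Lemma totally_measurable_indic A : borel A -> totally_measurable (indic A).
Proof.
move=> bA e e0; exists bool, (fun z => `[< A z >]), (fun b : bool => b%:R).
by split=> [|z]; [apply: borel_fibers_ind|rewrite subrr nm0 ltW].
Qed.

(** Each [z] is sent to the first point of a fine grid at distance less than [e] from [G z]. The
    strict inequality makes the sets [near] preimages of open balls, and taking the first such point
    makes every fibre one of these sets minus finitely many others. *)
Lemma totally_measurable_borel G (B : R) :
  (forall U, open U -> borel (G @^-1` U)) -> (forall z, nm (G z) <= B) ->
  totally_measurable G.
Proof.
move=> bG GB e e0; have d0 : 0 < e / 4 by rewrite divr_gt0.
set d := e / 4 in d0.
have B0 : 0 <= B by apply: le_trans (GB 0); apply: nm_ge0.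
(* [N * d] exceeds [B], so the multiples of [d] from [-N] to [N] come within [d] of every
   coordinate; two coordinates give [2 * d < e]. *)
pose N := (Num.truncn (B / d)).+1.
pose pt (jk : 'I_(N.*2.+1) * 'I_(N.*2.+1)) : R[i] :=
  Complex (d * (jk.1%:R - N%:R)) (d * (jk.2%:R - N%:R)).
have grid (x : R) : `|x| <= B ->
    exists j : 'I_(N.*2.+1), `|x - d * (j%:R - N%:R)| <= d.
  move=> xB; pose y := x / d + N%:R.
  have xd : `|x / d| <= N%:R.
    rewrite normrM normfV (gtr0_norm d0) ltW // (le_lt_trans _ (truncnS_gt _)) //.
    by rewrite ler_pM2r // invr_gt0.
  have y0 : 0 <= y by move: xd; rewrite ler_norml /y => /andP[]; lra.
  have yN : y <= N.*2%:R.
    by rewrite -addnn natrD /y; move: xd; rewrite ler_norml => /andP[]; lra.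
  have /andP[ty yt] := truncn_itv y0.
  have tN : (Num.truncn y < N.*2.+1)%N.
    by rewrite ltnS -(ler_nat R); apply: le_trans yN.
  exists (Ordinal tN) => /=.
  have -> : x - d * ((Num.truncn y)%:R - N%:R) = d * (y - (Num.truncn y)%:R).
    by rewrite /y; field; rewrite gt_eqF.
  rewrite normrM (gtr0_norm d0) ger_pMr //.
  rewrite ger0_norm ?subr_ge0 //; move: yt; rewrite -natr1; lra.
pose near jk := [set z | nm (pt jk - G z) < e].
have near_ex z : exists jk, near jk z.
  have [j jP] := grid (complex.Re (G z)) (le_trans (nm_ge_Re _) (GB z)).
  have [k kP] := grid (complex.Im (G z)) (le_trans (nm_ge_Im _) (GB z)).
  exists (j, k); rewrite /near /= nm_distC.
  apply: le_lt_trans (nm_le_ReIm _) _; case: (G z) jP kP => a b /= jP kP.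
  by have : 0 < d by []; rewrite /d in jP kP *; lra.
pose s := enum {: 'I_(N.*2.+1) * 'I_(N.*2.+1)}.
pose first z := find (fun jk => `[< near jk z >]) s.
have has_near z : has (fun jk => `[< near jk z >]) s.
  apply/hasP; have [jk jkz] := near_ex z.
  by exists jk; rewrite ?mem_enum //; apply/asboolP.
have first_lt z : (first z < size s)%N by rewrite -has_find.
have first_near z : near (nth (ord0, ord0) s (first z)) z.
  by have /asboolP := nth_find (ord0, ord0) (has_near z).
pose p z := Ordinal (first_lt z).
exists 'I_(size s), p, (fun i : 'I_(size s) => pt (nth (ord0, ord0) s i)).
have bnear jk : borel (near jk).
  have -> : near jk = G @^-1` (ball (pt jk) e%:C).
    by apply/seteqP; split=> z; rewrite /near /= -ball_normE /ball_ /= nmE ltcR.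
  by apply: bG; apply: ball_open; rewrite ltcR.
split=> [i|z]; last first.
  exact: ltW (first_near z).
have -> : p @^-1` [set i] = near (nth (ord0, ord0) s i) `&`
    ~` (\bigcup_(j in [set j | (j < i)%N]) near (nth (ord0, ord0) s j)).
  apply/seteqP; split=> z /=.
    move=> <-; split=> [|[j /= ji nz]].
      exact: first_near.
    by have := before_find (ord0, ord0) ji; move/negbT/negP; apply; apply/asboolP.
  move=> [nz nnz]; apply/val_inj => /=; apply/eqP.
  rewrite eqn_leq; apply/andP; split; rewrite leqNgt; apply/negP => lt.
    have := before_find (ord0, ord0) lt.
    by move/negbT/negP; apply; apply/asboolP.
  by apply: nnz; exists (first z).
apply: borelI => //; apply: borelC; rewrite bigcup_mkcond.
by apply: borel_bigcup => j; case: ifP => _ //; apply: borel0.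
Qed.

End TotallyMeasurable.

(** * The integral of a bounded Borel function *)

Section Calculus.
Variables (R : realType) (X : completeNormedModType R[i]).
Variable E : set R[i] -> X -> X.
Hypothesis hE : spectral_measure E.
Implicit Types (G H : R[i] -> R[i]) (S : X -> X).

(** A relation rather than a limit: a single simple function serves both approximations, so rules
    for [simple_op] pass to [S]. Closeness in operator norm is written vector by vector. *)
Definition is_calculus G S := forall e : R, 0 < e ->
  exists (T : finType) (p : R[i] -> T) (c : T -> R[i]),
    [/\ borel_fibers p, forall z, nm (c (p z) - G z) <= e &
        forall f, nm (simple_op E p c f - S f) <= e * nm f].

Lemma is_calculus_tm G S : is_calculus G S -> totally_measurable G.
Proof. by move=> cG e /cG[T [p [c []]]]; exists T, p, c. Qed.

(** The Cauchy estimate behind both uniqueness and existence: on the common refinement the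
    coefficients of two approximations of [G] differ by at most [e1 + e2] wherever they are
    attained. *)
Lemma simple_op_dist : exists2 K : R, 0 < K &
  forall (T U : finType) (p : R[i] -> T) (q : R[i] -> U) c d G (e1 e2 : R) f,
    borel_fibers p -> borel_fibers q ->
    (forall z, nm (c (p z) - G z) <= e1) -> (forall z, nm (d (q z) - G z) <= e2) ->
    nm (simple_op E p c f - simple_op E q d f) <= K * (e1 + e2) * nm f.
Proof.
have [K K0 KP] := simple_op_bound hE; exists K => // T U p q c d G e1 e2 f bp bq cG dG.
rewrite -simple_opB //; apply: KP => [|z]; first exact: borel_fibers_pair.
by rewrite /=; apply: le_trans (nm_trans (G z) _ _) _; rewrite [X in _ + X]nm_distC lerD.
Qed.

Lemma is_calculus_unique G S S' : is_calculus G S -> is_calculus G S' -> S = S'.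
Proof.
have [K K0 KP] := simple_op_dist => cS cS'; apply/funext => f; apply/eqP.
rewrite -subr_eq0; apply/eqP; apply: nm_le_eq0 => e e0.
have D0 : 0 < (2 * K + 2) * nm f + 1 by have := nm_ge0 f; nra.
have e'0 : 0 < e / ((2 * K + 2) * nm f + 1) by rewrite divr_gt0.
set e' := e / _ in e'0; have ee' : e = e' * ((2 * K + 2) * nm f + 1).
  by rewrite divfK // gt_eqF.
have [T [p [c [bp cG cSf]]]] := cS _ e'0; have [U [q [d [bq dG dSf]]]] := cS' _ e'0.
have := KP _ _ _ _ _ _ _ _ _ f bp bq cG dG; have := cSf f; have := dSf f.
have := nm_trans (simple_op E p c f) (S f) (S' f).
have := nm_trans (simple_op E q d f) (simple_op E p c f) (S' f).
by rewrite [nm (S f - simple_op _ _ _ _)]nm_distC; lra.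
Qed.

(** Approximants with error [1 / (n + 1)] are Cauchy at each [f] at a rate proportional to [nm f],
    so their pointwise limit is also a limit in operator norm. *)
Lemma is_calculus_ex G : totally_measurable G -> exists S, is_calculus G S.
Proof.
move=> tG; have [K K0 KP] := simple_op_dist.
pose e n : R := n.+1%:R^-1.
have e0 n : 0 < e n by rewrite invr_gt0.
have e_small (d : R) : 0 < d -> exists N, forall n, (N <= n)%N -> e n <= d.
  move=> d0; have [N] := ltr_add_invr d0; rewrite add0r => Nd.
  exists N => n Nn; apply: le_trans (ltW Nd).
  by rewrite lef_pV2 ?posrE // ler_nat ltnS.
have /choice[s sP] : forall n, exists s : X -> X, exists (T : finType)
    (p : R[i] -> T) (c : T -> R[i]),
    [/\ borel_fibers p, forall z, nm (c (p z) - G z) <= e n & s = simple_op E p c].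
  by move=> n; have [T [p [c [bp cG]]]] := tG _ (e0 n);
    exists (simple_op E p c), T, p, c.
have sB m n f : nm (s m f - s n f) <= K * (e m + e n) * nm f.
  have [T [p [c [bp cG ->]]]] := sP m; have [U [q [d [bq dG ->]]]] := sP n.
  exact: KP bp bq cG dG.
have K1 f : 0 < 2 * K * (nm f + 1).
  by rewrite !mulr_gt0 // ltr_wpDl // nm_ge0.
have /choice[S SP] : forall f, exists l : X, (fun n => s n f) @ \oo --> l.
  move=> f; apply: cauchy_nm => d d0.
  have /e_small[N NP] : 0 < d / (2 * K * (nm f + 1)) by rewrite divr_gt0.
  exists N => m n /NP em /NP en; apply: le_trans (sB _ _ _) _.
  move: em en; rewrite !ler_pdivlMr // => em en.
  have := mulr_gt0 K0 (e0 m); have := mulr_gt0 K0 (e0 n); lra.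
have sS n f : nm (s n f - S f) <= 2 * K * e n * nm f.
  rewrite nm_distC; apply/ler_addgt0Pr => d d0.
  have /cvgn_nmP/(_ (d / 2)) := SP f; rewrite divr_gt0 // => /(_ isT)[N1 N1P].
  have [N2 N2P] := e_small _ (e0 n).
  pose m := maxn N1 N2.
  have := N1P m (leq_maxl _ _); have em := N2P m (leq_maxr _ _).
  have := sB m n f; have := nm_trans (s m f) (S f) (s n f).
  have : K * (e m + e n) * nm f <= 2 * K * e n * nm f.
    apply: ler_wpM2r; first exact: nm_ge0.
    rewrite [2 * K]mulrC -mulrA; apply: ler_wpM2l; [exact: ltW|lra].
  lra.
exists S => d d0.
have /e_small[N /(_ _ (leqnn N)) NP] : 0 < d / (2 * K + 1) by rewrite divr_gt0 //; lra.
have Nd : e N * (2 * K + 1) <= d by rewrite -ler_pdivlMr //; lra.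
have Kd : 2 * K * e N <= d by have := e0 N; lra.
have Nd' : e N <= d by have := mulr_gt0 K0 (e0 N); lra.
have [T [p [c [bp cG es]]]] := sP N; exists T, p, c; split=> // [z|f].
  exact: le_trans (cG z) _.
rewrite -es; apply: le_trans (sS N f) _.
by apply: ler_wpM2r => //; apply: nm_ge0.
Qed.

Definition calculus G : X -> X := xget (fun=> 0) [set S | is_calculus G S].

Lemma calculusP G : totally_measurable G -> is_calculus G (calculus G).
Proof. by move=> /is_calculus_ex[S cS]; rewrite /calculus; apply: xgetPex; exists S. Qed.

Lemma calculusE G S : is_calculus G S -> calculus G = S.
Proof.
by move=> cS; apply: (is_calculus_unique _ cS); apply: calculusP (is_calculus_tm cS).
Qed.

Lemma is_calculus_bound : exists2 K : R, 0 < K & forall G S (B : R) f,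
  is_calculus G S -> (forall z, nm (G z) <= B) -> nm (S f) <= K * B * nm f.
Proof.
have [K K0 KP] := simple_op_bound hE; exists K => // G S B f cG GB.
apply/ler_addgt0Pr => d d0.
have D0 : 0 < (K + 1) * nm f + 1 by have := nm_ge0 f; nra.
have e0 : 0 < d / ((K + 1) * nm f + 1) by rewrite divr_gt0.
set e := d / _ in e0; have ee : d = e * ((K + 1) * nm f + 1).
  by rewrite divfK // gt_eqF.
have [T [p [c [bp cGe cS]]]] := cG _ e0.
have cB z : nm (c (p z)) <= B + e.
  have := nmD (c (p z) - G z) (G z); rewrite subrK.
  by have := cGe z; have := GB z; lra.
have := KP _ _ _ _ f bp cB; have := cS f.
by have := nm_lerB (S f) (simple_op E p c f); rewrite nm_distC; lra.
Qed.

Lemma calculus_bounded_operator G :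
  totally_measurable G -> bounded_operator (calculus G).
Proof.
move=> tG; apply/bounded_operatorP; split; last first.
  have [K K0 KP] := is_calculus_bound; have [B GB] := totally_measurable_bounded tG.
  exists (K * B); last by move=> f; apply: KP (calculusP tG) GB.
  by apply: mulr_ge0; [apply: ltW|apply: le_trans (nm_ge0 _) (GB 0)].
move=> a f g; apply/eqP; rewrite -subr_eq0; apply/eqP; apply: nm_le_eq0 => d d0.
pose D := nm (a *: f + g) + nm a * nm f + nm g.
have D0 : 0 < D + 1 by rewrite ltr_wpDl // !addr_ge0 ?mulr_ge0 // nm_ge0.
have e0 : 0 < d / (D + 1) by rewrite divr_gt0.
set e := d / _ in e0; have ee : d = e * (D + 1) by rewrite divfK // gt_eqF.
have [T [p [c [bp _ cS]]]] := calculusP tG e0.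
set C := calculus G in cS *; set s := simple_op E p c in cS.
have -> : C (a *: f + g) - (a *: C f + C g) =
    - (s (a *: f + g) - C (a *: f + g)) + (a *: (s f - C f) + (s g - C g)).
  have -> : s (a *: f + g) = a *: s f + s g by apply: (simple_op_lin hE c bp).
  by rewrite opprB scalerBr [a *: s f - _ + _]addrACA -opprD addrA subrK.
apply: le_trans (nmD _ _) _; rewrite nmN.
have := nmD (a *: (s f - C f)) (s g - C g); rewrite nmZ.
have := cS (a *: f + g); have := cS g.
by have := ler_wpM2l (nm_ge0 a) (cS f); rewrite /D in ee; lra.
Qed.

Lemma calculus_lin G : totally_measurable G -> linear (calculus G).
Proof. by move=> /calculus_bounded_operator/bounded_lin. Qed.

Lemma is_calculus_simple (T : finType) (p : R[i] -> T) c :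
  borel_fibers p -> is_calculus (c \o p) (simple_op E p c).
Proof.
move=> bp e e0; exists T, p, c; split=> // [z|f].
  by rewrite subrr nm0 ltW.
by rewrite subrr nm0 mulr_ge0 ?nm_ge0 // ltW.
Qed.

Lemma is_calculus_indic A : borel A -> is_calculus (indic A) (E A).
Proof.
move=> bA; have := is_calculus_simple (fun b : bool => b%:R) (borel_fibers_ind bA).
congr is_calculus; apply/funext => f.
rewrite /simple_op big_bool /= scale0r addr0 scale1r; congr (E _ f).
by apply/seteqP; split=> z /=; move/asboolP.
Qed.

Lemma is_calculus_cst a : is_calculus (fun=> a) (fun f => a *: f).
Proof.
have bp : borel_fibers (fun _ : R[i] => tt).
  move=> []; have -> : (fun=> tt) @^-1` [set tt] = [set: R[i]].
    by apply/seteqP.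
  exact: borelT.
have := is_calculus_simple (fun=> a) bp; congr is_calculus.
apply/funext => f; rewrite /simple_op (big_pred1 tt) => [|[]//].
have -> : (fun=> tt) @^-1` [set tt] = [set: R[i]] by apply/seteqP.
by rewrite (spectral_setT hE).
Qed.

Lemma is_calculusB G H S S' : is_calculus G S -> is_calculus H S' ->
  is_calculus (fun z => G z - H z) (fun f => S f - S' f).
Proof.
move=> cG cH e e0; have e20 : 0 < e / 2 by rewrite divr_gt0.
have [T [p [c [bp cG' cS]]]] := cG _ e20; have [U [q [d [bq dH dS']]]] := cH _ e20.
exists _, (fun z => (p z, q z)), (fun tu => c tu.1 - d tu.2); split=> [|z|f].
- exact: borel_fibers_pair.
- rewrite /= subrACA.
  by have := nmB (c (p z) - G z) (d (q z) - H z); have := cG' z; have := dH z; lra.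
- rewrite simple_opB // subrACA; have := cS f; have := dS' f.
  by have := nmB (simple_op E p c f - S f) (simple_op E q d f - S' f); lra.
Qed.

(** Multiplicativity of [E] on intersections gives the rule for simple operators; the approximation
    errors are then split as for a product of numbers. *)
Lemma is_calculusM G H S S' : is_calculus G S -> is_calculus H S' ->
  is_calculus (fun z => G z * H z) (S \o S').
Proof.
move=> cG cH; have [K K0 KP] := simple_op_bound hE.
have [B GB] := totally_measurable_bounded (is_calculus_tm cG).
have [B' HB] := totally_measurable_bounded (is_calculus_tm cH).
have /bounded_operatorP[_ [C C0 CP]] : bounded_operator S'.
  by rewrite -(calculusE cH); apply: calculus_bounded_operator (is_calculus_tm cH).
(* The constant [D] below collects the error [B + B' + 1] of the symbols and the errors
   [K * (B + 1)] and [C] of the operators; [d <= 1] keeps the simple approximation of [G] below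
   [B + 1]. *)
have B0 : 0 <= B by apply: le_trans (GB 0); apply: nm_ge0.
have B'0 : 0 <= B' by apply: le_trans (HB 0); apply: nm_ge0.
move=> e e0; pose D := B + B' + 1 + K * (B + 1) + C.
have KB : 0 < K * (B + 1) by rewrite mulr_gt0 //; lra.
have D0 : 0 < D by rewrite /D; lra.
pose d := Num.min 1 (e / D).
have d0 : 0 < d by rewrite lt_min ltr01 divr_gt0.
have d1 : d <= 1 by rewrite ge_min lexx.
have dD : d * D <= e by rewrite -ler_pdivlMr // ge_min lexx orbT.
have [T [p [c [bp cG' cS]]]] := cG _ d0; have [U [q [k [bq kH kS']]]] := cH _ d0.
have cB z : nm (c (p z)) <= B + 1.
  have := nmD (c (p z) - G z) (G z); rewrite subrK.
  by have := cG' z; have := GB z; lra.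
exists _, (fun z => (p z, q z)), (fun tu => c tu.1 * k tu.2); split=> [|z|f].
- exact: borel_fibers_pair.
- have -> : c (p z) * k (q z) - G z * H z =
      c (p z) * (k (q z) - H z) + (c (p z) - G z) * H z by ring.
  apply: le_trans (nmD _ _) _; rewrite !nmM.
  have := ler_pM (nm_ge0 _) (nm_ge0 _) (cB z) (kH z).
  have := ler_pM (nm_ge0 _) (nm_ge0 _) (cG' z) (HB z).
  by have := mulr_gt0 d0 KB; have := mulr_ge0 (ltW d0) C0; rewrite /D in dD; lra.
- rewrite simple_opM //= -(subrKA (simple_op E p c (S' f))).
  apply: le_trans (nmD _ _) _; rewrite -(linB (simple_op_lin hE _ bp)).
  have := KP _ _ _ _ (simple_op E q k f - S' f) bp cB.
  have := ler_wpM2l (ltW KB) (kS' f); have := cS (S' f).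
  have := ler_wpM2l (ltW d0) (CP f).
  have := ler_wpM2r (nm_ge0 f) dD.
  have : 0 <= d * (B + B' + 1) * nm f by rewrite !mulr_ge0 ?nm_ge0 //; lra.
  by rewrite /D; lra.
Qed.

End Calculus.

Section BorelFunctions.
Variable R : realType.

Lemma uniform_nmP (S : set R[i]) (s : nat -> R[i] -> R[i]) (F : R[i] -> R[i]) :
  {uniform S, s @ \oo --> F} <->
  forall e : R, 0 < e -> exists N, forall n, (N <= n)%N ->
    forall z, S z -> nm (F z - s n z) <= e.
Proof.
split=> [sF e e0|sF P /uniform_nbhs[D [/= entD DP]]].
  have /sF[N _ NP] : nbhs (F : {uniform` S -> R[i]})
      [set h | forall y, S y -> ball (F y) e%:C (h y)].
    apply/uniform_nbhs; exists [set xy | ball xy.1 e%:C xy.2]; split => //.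
    by rewrite -entourage_ballE; exists e%:C => //=; rewrite ltcR.
  exists N => n /NP /= h z /h; rewrite -ball_normE /ball_ /= nmE ltcR.
  exact: ltW.
move: entD; rewrite -entourage_ballE => -[[e e'] /=].
rewrite ltcE /= => /andP[/eqP -> e0] eD.
have /sF[N NP] : 0 < e / 2 by rewrite divr_gt0.
exists N => // n /= Nn; apply: DP => z Sz; apply: eD => /=.
rewrite -ball_normE /ball_ /= nmE complexr0 ltcR.
by apply: le_lt_trans (NP _ Nn _ Sz) _; rewrite ltr_pdivrMr // ltr_pMr // ltr1n.
Qed.

(** Continuity is required only on an open set around [A], which admits functions such as an inverse
    with its pole outside [V]. *)
Lemma totally_measurable_cut (A V : set R[i]) (G : R[i] -> R[i]) (B : R) :
  borel A -> open V -> A `<=` V -> (forall z, V z -> {for z, continuous G}) ->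
  (forall z, A z -> nm (G z) <= B) ->
  totally_measurable (fun z => indic A z * G z).
Proof.
move=> bA oV AV cG GB; apply: (@totally_measurable_borel _ _ `|B|) => [U oU|z].
  have -> : (fun z => indic A z * G z) @^-1` U =
      (A `&` (V `&` G @^-1` U)) `|` (~` A `&` [set _ | U 0]).
    apply/seteqP; split=> z /=; rewrite /indic; case: asboolP => Az.
    - by rewrite mul1r; left; do 2!split => //; apply: AV.
    - by rewrite mul0r; right.
    - by rewrite mul1r => -[[_ []]|[]].
    - by rewrite mul0r => -[[]|[]].
  have bU0 : borel [set _ : R[i] | U 0].
    have [U0|U0] := pselect (U 0).
      by rewrite (_ : [set _ | _] = setT); [apply: borelT|apply/seteqP; split].
    by rewrite (_ : [set _ | _] = set0); [apply: borel0|apply/seteqP; split].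
  apply: borelU; apply: borelI => //; last exact: borelC.
  apply: borel_open; rewrite openE => z [Vz Uz]; apply: filterI.
    exact: open_nbhs_nbhs.
  by apply: (cG z Vz); apply: open_nbhs_nbhs.
rewrite nmM /indic; case: asboolP => Az; last by rewrite nm0 mul0r.
by rewrite nm1 mul1r; apply: le_trans (GB z Az) (ler_norm _).
Qed.

Lemma totally_measurable_cut_id (A : set R[i]) (B : R) :
  borel A -> (forall z, A z -> nm z <= B) ->
  totally_measurable (fun z => indic A z * z).
Proof.
move=> bA AB; apply: (totally_measurable_cut bA openT _ _ AB) => // z _.
exact: cvg_id.
Qed.

Lemma open_nm_gt (r : R) (c : R[i]) : open [set z : R[i] | r < nm (z - c)].
Proof.
rewrite openE => z /= rz.
have e0 : 0 < (nm (z - c) - r) / 2 by rewrite divr_gt0 // subr_gt0.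
apply: filterS (nm_near z e0) => y /= zy.
by have := nm_lerB (z - c) (y - c); rewrite subrACA subrr subr0; lra.
Qed.

Lemma borel_nm_le (r : R) : borel [set z : R[i] | nm z <= r].
Proof.
have -> : [set z : R[i] | nm z <= r] = ~` [set z | r < nm (z - 0)].
  by apply/seteqP; split=> z /=; rewrite subr0 leNgt => /negP.
by apply: borelC; apply: borel_open; apply: open_nm_gt.
Qed.

End BorelFunctions.

(** * The bounded integral as a value of the calculus *)

Section BoundedIntegral.
Variables (R : realType) (X : completeNormedModType R[i]).
Variable E : set R[i] -> X -> X.
Hypothesis hE : spectral_measure E.
Variable S : set R[i].
Hypothesis bS : borel S.

(** The finite set of values of [s], seen as a finite type, labels the partition and turns the sum
    over [range s] into a [simple_op]. *)
Lemma simple_integral_calculus (s : R[i] -> R[i]) : simple_function s ->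
  is_calculus E (fun z => indic S z * s z) (simple_integral E S s).
Proof.
move=> [fs bs]; pose r := fset_set (range s).
have sr z : s z \in r by rewrite in_fset_set // mem_set //; exists z.
pose p z : r := [` sr z]%fset.
have bp : borel_fibers p.
  move=> t; have := bs (val t); congr borel; apply/seteqP; split=> z /=.
    by move=> szt; apply/val_inj.
  by move=> <-.
have := is_calculusM hE (is_calculus_indic E bS)
  (is_calculus_simple E (fun t : r => val t) bp).
congr is_calculus; apply/funext => f.
rewrite /simple_integral (fsbig_finite _ _ fs) -/r big_seq_fsetE /=.
rewrite (lin_sum (spectral_lin hE bS)); apply: eq_bigr => t _.
rewrite (linZ (spectral_lin hE bS)) -spectral_setIA //; congr (_ *: E _ f).
congr (_ `&` _); apply/seteqP; split=> z /=; first by move=> <-.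
by move=> szt; apply/val_inj.
Qed.

Variable F : R[i] -> R[i].
Hypothesis tF : totally_measurable (fun z => indic S z * F z).

Lemma is_bounded_integral_calculus :
  is_bounded_integral E S F (calculus E (fun z => indic S z * F z)).
Proof.
split; first exact: calculus_bounded_operator.
have /choice[s sP] : forall n, exists s : R[i] -> R[i], simple_function s /\
    forall z, nm (s z - indic S z * F z) <= n.+1%:R^-1.
  move=> n; have n0 : 0 < n.+1%:R^-1 :> R by rewrite invr_gt0.
  have [T [p [c [bp cF]]]] := tF n0.
  exists (c \o p); split=> //; split.
    apply: (@sub_finite_set _ _ (c @` setT)); last exact: finite_image.
    by move=> _ [z _ <-]; exists (p z).
  by move=> a; have := borel_fibers_pred (fun t => c t == a) bp;
    congr borel; apply/seteqP; split=> z /eqP.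
have e_small (e : R) : 0 < e -> exists N, forall n, (N <= n)%N -> n.+1%:R^-1 <= e.
  move=> d0; have [N] := ltr_add_invr d0; rewrite add0r => Nd.
  exists N => n Nn; apply: le_trans (ltW Nd).
  by rewrite lef_pV2 ?posrE // ler_nat ltnS.
have [K K0 KP] := is_calculus_bound hE.
have cs n := simple_integral_calculus (sP n).1.
exists s; split=> [n||]; first by have [] := sP n.
  apply/uniform_nmP => e /e_small[N NP]; exists N => n /NP ne z Sz.
  apply: le_trans ne; rewrite nm_distC; have := (sP n).2 z.
  by rewrite /indic; case: asboolP => // _; rewrite mul1r.
apply/cvgrPdist_le => e e0; have /e_small[N NP] : 0 < e / K by rewrite divr_gt0.
exists N => // n /= /NP ne; rewrite sub0r normrN.
have bo : bounded_operator (fun f => simple_integral E S (s n) f -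
    calculus E (fun z => indic S z * F z) f).
  apply: bounded_operatorB; last exact: calculus_bounded_operator.
  rewrite -(calculusE hE (cs n)); apply: calculus_bounded_operator => //.
  exact: is_calculus_tm (cs n).
rewrite ger0_norm ?opnorm_ge0 //; apply: opnorm_le => // [|f]; first exact: ltW.
have cd := is_calculusB hE (cs n) (calculusP hE tF).
apply: le_trans (KP _ _ n.+1%:R^-1 f cd _) _ => [z|].
  rewrite -mulrBr nmM; have := (sP n).2 z; rewrite /indic; case: asboolP => _.
    by rewrite nm1 !mul1r.
  by move=> _; rewrite nm0 mul0r invr_ge0.
apply: ler_wpM2r; first exact: nm_ge0.
by rewrite mulrC -ler_pdivlMr.
Qed.

(** This pins down the choice made by [bounded_integral]. Uniform convergence is known only on [S],
    which suffices because both symbols carry the factor [indic S]. *)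
Lemma is_bounded_integral_unique T : is_bounded_integral E S F T ->
  T = calculus E (fun z => indic S z * F z).
Proof.
move=> [bT [s [ss /uniform_nmP sF sT]]]; have [K K0 KP] := is_calculus_bound hE.
apply/funext => f; apply/eqP; rewrite -subr_eq0; apply/eqP; apply: nm_le_eq0 => d d0.
have D0 : 0 < (K + 1) * nm f + 1 by have := nm_ge0 f; nra.
have e0 : 0 < d / ((K + 1) * nm f + 1) by rewrite divr_gt0.
set e := d / _ in e0; have ee : d = e * ((K + 1) * nm f + 1).
  by rewrite divfK // gt_eqF.
have [N1 N1P] := sF _ e0.
have /cvgrPdist_le /(_ _ e0)[N2 _ N2P] := sT.
pose n := maxn N1 N2; have cs := simple_integral_calculus (ss n).
have bo : bounded_operator (fun f => simple_integral E S (s n) f - T f).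
  apply: bounded_operatorB => //.
  rewrite -(calculusE hE cs); apply: calculus_bounded_operator => //.
  exact: is_calculus_tm cs.
have := N2P n (leq_maxr _ _); rewrite /= sub0r normrN ger0_norm ?opnorm_ge0 // => on.
have := nm_le_opnorm f bo.
have cd := is_calculusB hE cs (calculusP hE tF).
have : nm (simple_integral E S (s n) f -
    calculus E (fun z => indic S z * F z) f) <= K * e * nm f.
  apply: KP cd _ => z.
  rewrite -mulrBr nmM; have := N1P n (leq_maxl _ _) z.
  rewrite /indic nm_distC; case: asboolP => Sz.
    by rewrite nm1 mul1r; apply.
  by move=> _; rewrite nm0 mul0r ltW.
have := nm_trans (simple_integral E S (s n) f) (T f)
  (calculus E (fun z => indic S z * F z) f).
rewrite [nm (T f - simple_integral _ _ _ _)]nm_distC.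
have := ler_wpM2r (nm_ge0 f) on; lra.
Qed.

Lemma bounded_integral_calculus :
  bounded_integral E S F = calculus E (fun z => indic S z * F z).
Proof.
apply: is_bounded_integral_unique; apply: xgetPex.
by exists (calculus E (fun z => indic S z * F z)); apply: is_bounded_integral_calculus.
Qed.

End BoundedIntegral.

(** * Support of a spectral measure and the unbounded integral *)

Section CalculusAlgebra.
Variables (R : realType) (X : completeNormedModType R[i]).
Variable E : set R[i] -> X -> X.
Hypothesis hE : spectral_measure E.
Implicit Types G H : R[i] -> R[i].

Lemma calculusM G H f : totally_measurable G -> totally_measurable H ->
  calculus E (fun z => G z * H z) f = calculus E G (calculus E H f).
Proof.
move=> tG tH.
by rewrite (calculusE hE (is_calculusM hE (calculusP hE tG) (calculusP hE tH))).
Qed.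

Lemma calculusB G H f : totally_measurable G -> totally_measurable H ->
  calculus E (fun z => G z - H z) f = calculus E G f - calculus E H f.
Proof.
move=> tG tH.
by rewrite (calculusE hE (is_calculusB hE (calculusP hE tG) (calculusP hE tH))).
Qed.

Lemma calculus_comm G H f : totally_measurable G -> totally_measurable H ->
  calculus E G (calculus E H f) = calculus E H (calculus E G f).
Proof.
move=> tG tH; rewrite -!calculusM //.
by congr (calculus E _ f); apply/funext => z; rewrite mulrC.
Qed.

Lemma totally_measurableM G H : totally_measurable G -> totally_measurable H ->
  totally_measurable (fun z => G z * H z).
Proof.
move=> tG tH.
exact: is_calculus_tm (is_calculusM hE (calculusP hE tG) (calculusP hE tH)).
Qed.

Lemma totally_measurableB G H : totally_measurable G -> totally_measurable H ->
  totally_measurable (fun z => G z - H z).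
Proof.
move=> tG tH.
exact: is_calculus_tm (is_calculusB hE (calculusP hE tG) (calculusP hE tH)).
Qed.

End CalculusAlgebra.

Lemma calculus_indic (R : realType) (X : completeNormedModType R[i])
    (E : set R[i] -> X -> X) A :
  spectral_measure E -> borel A -> calculus E (indic A) = E A.
Proof. by move=> hE bA; apply: (calculusE hE (is_calculus_indic E bA)). Qed.

Section Support.
Variables (R : realType) (X : completeNormedModType R[i]).
Variable E : set R[i] -> X -> X.
Hypothesis hE : spectral_measure E.
Implicit Types (A B : set R[i]) (f : X).

Lemma spectral_null_subset A B : borel A -> borel B -> A `<=` B ->
  E B = (fun=> 0) -> E A = (fun=> 0).
Proof.
move=> bA bB /setIidPl AB B0; apply/funext => f.
by rewrite -AB (spectral_setIA hE) // B0 (lin0 (spectral_lin hE bA)).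
Qed.

Lemma borel_seqD (F : nat -> set R[i]) : (forall n, borel (F n)) ->
  forall n, borel (seqD F n).
Proof. by move=> bF [|n] //=; apply: borelD. Qed.

Lemma borel_seqDU (F : nat -> set R[i]) : (forall n, borel (F n)) ->
  forall n, borel (seqDU F n).
Proof. exact: (@seqDU_measurable _ (g_sigma_algebraType (@open R[i]))). Qed.

Lemma spectral_null_bigcup (F : nat -> set R[i]) : (forall n, borel (F n)) ->
  (forall n, E (F n) = (fun=> 0)) -> E (\bigcup_n F n) = (fun=> 0).
Proof.
move=> bF F0; apply/funext => f; rewrite seqDU_bigcup_eq.
have lim1 := @spectral_sigma_additive _ _ _ hE _ (borel_seqDU bF) (trivIset_seqDU F) f.
apply: (cvg_nm_unique lim1); apply/cvgn_nmP => e e0; exists 0%N => n _.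
rewrite big1 ?subrr ?nm0 ?ltW // => k _.
rewrite (@spectral_null_subset _ (F k)) //; [exact: borel_seqDU|exact: subset_seqDU].
Qed.

Lemma spectral_nondecreasing_cvg (F : nat -> set R[i]) f :
  (forall n, borel (F n)) -> nondecreasing_seq F ->
  E (F n) f @[n --> \oo] --> E (\bigcup_n F n) f.
Proof.
move=> bF ndF; rewrite -eq_bigcup_seqD.
have := @spectral_sigma_additive _ _ _ hE _ (borel_seqD bF) (trivIset_seqD ndF) f.
have sumE n : \sum_(0 <= k < n.+1) E (seqD F k) f = E (F n) f.
  elim: n => [|n IHn]; first by rewrite big_nat1.
  rewrite (@big_nat_recr _ _ _ n.+1 0) //= IHn.
  rewrite (spectral_setD hE _ (bF _) (bF _)); last exact/subsetPset/ndF.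
  by rewrite addrC subrK.
rewrite -cvg_shiftS /=; apply: cvg_trans.
by apply: near_eq_cvg; apply: nearW => n /=; rewrite sumE.
Qed.

Lemma closed_spectral_support : closed (spectral_support E).
Proof.
rewrite -[spectral_support E]setCK; apply: open_closedC; rewrite openE => z /= nz.
have [U oU [Uz U0]] : exists2 U, open U & U z /\ E U = (fun=> 0).
  apply: contrapT => H; apply: nz => U oU Uz U0; apply: H.
  by exists U.
apply: filterS (open_nbhs_nbhs (conj oU Uz)) => y Uy Sy.
exact: Sy oU Uy U0.
Qed.

Lemma borel_spectral_support : borel (spectral_support E).
Proof. by apply: borel_closed; apply: closed_spectral_support. Qed.

(* The complement of the support is covered by the countably many null balls
   with rational centre and radius. *)
Lemma spectral_support_null : E (~` spectral_support E) = (fun=> 0).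
Proof.
pose Q := (rat * rat * rat)%type.
pose b (q : Q) : set R[i] :=
  [set z | nm (Complex (ratr q.1.1) (ratr q.1.2) - z) < ratr q.2].
pose F n : set R[i] := if unpickle n is Some q then
  if `[< E (b q) = (fun=> 0) >] then b q else set0 else set0.
have FE q : E (b q) = (fun=> 0) -> b q `<=` \bigcup_n F n.
  move=> bq0 z bz; exists (pickle q); first by [].
  by rewrite /F pickleK asboolT.
have ob q : open (b q).
  rewrite openE => z bz; rewrite /b /= in bz *.
  have e0 : 0 < (ratr q.2 - nm (Complex (ratr q.1.1) (ratr q.1.2) - z)) / 2.
    by rewrite divr_gt0 // subr_gt0.
  apply: filterS (nm_near z e0) => y /= zy.
  have := nm_trans z (Complex (ratr q.1.1) (ratr q.1.2)) y; lra.
have bF n : borel (F n).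
  rewrite /F; case: unpickle => [q|]; last exact: borel0.
  by case: ifP => _; [apply: borel_open|apply: borel0].
have F0 n : E (F n) = (fun=> 0).
  rewrite /F; case: unpickle => [q|]; last exact: spectral_set0.
  by case: asboolP => // _; apply: spectral_set0.
apply: spectral_null_subset (spectral_null_bigcup bF F0).
- exact: borelC borel_spectral_support.
- exact: borel_bigcup.
move=> z nz; have [U oU [Uz U0]] : exists2 U, open U & U z /\ E U = (fun=> 0).
  apply: contrapT => H; apply: nz => U oU Uz U0; apply: H.
  by exists U.
have := open_nbhs_nbhs (conj oU Uz) => /nbhs_ballP[[e e'] /=].
rewrite ltcE /= => /andP[/eqP -> e0] eU.
(* A centre within [e / 8] of [z] in each coordinate lies at distance less than [e / 4], hence less
   than the radius; since the radius is below [e / 2], the rational ball stays inside the ball of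
   radius [e] around [z]. *)
have [r r1 r2] : exists2 r : rat, e / 4 < ratr r & ratr r < e / 2 :> R.
  have : e / 4 < e / 2 by lra.
  by move=> /rat_in_itvoo[r]; rewrite in_itv /= => /andP[]; exists r.
have [x x1] : exists x : rat, `|ratr x - complex.Re z| < e / 8.
  have : complex.Re z - e / 8 < complex.Re z + e / 8 by lra.
  move=> /rat_in_itvoo[x]; rewrite in_itv /= => /andP[? ?]; exists x.
  by rewrite ltr_norml; apply/andP; split; lra.
have [y y1] : exists y : rat, `|ratr y - complex.Im z| < e / 8.
  have : complex.Im z - e / 8 < complex.Im z + e / 8 by lra.
  move=> /rat_in_itvoo[y]; rewrite in_itv /= => /andP[? ?]; exists y.
  by rewrite ltr_norml; apply/andP; split; lra.
have qz : b (x, y, r) z.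
  rewrite /b /=; apply: le_lt_trans (nm_le_ReIm _) _.
  by case: z x1 y1 {nz Uz eU} => u v /=; lra.
apply: (FE _ _ _ qz).
apply: (spectral_null_subset _ (borel_open oU) _ U0); first exact: borel_open.
move=> w bw; apply: eU; rewrite -ball_normE /ball_ /= nmE complexr0 ltcR.
apply: le_lt_trans (nm_trans (Complex (ratr x) (ratr y)) _ _) _.
by rewrite nm_distC; move: qz bw; rewrite /b /=; lra.
Qed.

(** This instantiates the hypotheses of the following sections, which work over any Borel set [S]
    such that [E S] is the identity. *)
Lemma spectral_support_id f : E (spectral_support E) f = f.
Proof.
have bS := borel_spectral_support.
have := spectral_setU hE f bS (borelC bS) (setICr _).
by rewrite setUv (spectral_setT hE) spectral_support_null addr0.
Qed.

End Support.

Section SpectralIntegral.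
Variables (R : realType) (X : completeNormedModType R[i]).
Variable E : set R[i] -> X -> X.
Hypothesis hE : spectral_measure E.

Lemma calculus_cst a f : calculus E (fun=> a) f = a *: f.
Proof. by rewrite (calculusE hE (is_calculus_cst hE a)). Qed.

Lemma totally_measurable_cst a : totally_measurable (fun _ : R[i] => a).
Proof. exact: is_calculus_tm (is_calculus_cst hE a). Qed.

Variable S : set R[i].
Hypothesis bS : borel S.
Hypothesis ES : forall f, E S f = f.

Definition cutoff n : set R[i] := S `&` [set z | `|z| <= n%:R].

Lemma cutoffE n : cutoff n = S `&` [set z | nm z <= n%:R].
Proof.
congr (_ `&` _); apply/seteqP; split=> z /=;
by rewrite nmE -(rmorph_nat (real_complex R)) lecR.
Qed.

Lemma borel_cutoff n : borel (cutoff n).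
Proof. by rewrite cutoffE; apply: borelI => //; apply: borel_nm_le. Qed.

Lemma cutoff_nm n z : cutoff n z -> nm z <= n%:R.
Proof. by rewrite cutoffE => -[]. Qed.

Lemma cutoff_cvg f : E (cutoff n) f @[n --> \oo] --> f.
Proof.
have -> : nbhs f = nbhs (E (\bigcup_n cutoff n) f).
  rewrite -{1}[f]ES; congr (nbhs (E _ f)); apply/seteqP; split=> z.
    move=> Sz; exists (Num.truncn (nm z)).+1 => //; rewrite cutoffE; split=> //=.
    exact: ltW (truncnS_gt _).
  by case=> n _ [].
apply: spectral_nondecreasing_cvg; [exact: hE|exact: borel_cutoff|].
move=> m n mn; apply/subsetPset => z; rewrite !cutoffE => -[Sz /= zm]; split => //=.
by apply: le_trans zm _; rewrite ler_nat.
Qed.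

Definition cut_op n : X -> X := calculus E (fun z => indic (cutoff n) z * z).

Lemma totally_measurable_cut_op n :
  totally_measurable (fun z => indic (cutoff n) z * z).
Proof. exact: totally_measurable_cut_id (borel_cutoff n) (@cutoff_nm n). Qed.

Lemma truncated_integral_id f n : truncated_integral E S id f n = cut_op n f.
Proof.
rewrite /truncated_integral bounded_integral_calculus //.
  exact: borel_cutoff.
exact: totally_measurable_cut_op.
Qed.

Lemma indicM (A B : set R[i]) z : indic A z * indic B z = indic (A `&` B) z.
Proof.
by rewrite /indic -natrM mulnb -asbool_and.
Qed.

Lemma cut_op_proj m n f : (m <= n)%N -> E (cutoff m) (cut_op n f) = cut_op m f.
Proof.
move=> mn; rewrite -[E (cutoff m)](calculus_indic hE (borel_cutoff m)).
rewrite -calculusM //; last exact: totally_measurable_cut_op.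
  congr (calculus E _ f); apply/funext => z; rewrite mulrA indicM.
  congr (indic _ z * z); apply/seteqP; split=> y; first by case.
  rewrite !cutoffE => -[Sy /= ym]; do 2!split=> //=.
  by apply: le_trans ym _; rewrite ler_nat.
by apply: totally_measurable_indic; apply: borel_cutoff.
Qed.

Let B := spectral_integral E S id.

Lemma spectral_integral_domP f g :
  cut_op n f @[n --> \oo] --> g <-> dom B f /\ B f = g.
Proof.
have -> : (fun n => cut_op n f) = truncated_integral E S id f.
  by apply/funext => n; rewrite truncated_integral_id.
split=> [fg|[df <-]]; last exact: df.
by split; [apply/cvg_ex; exists g|apply/cvg_lim].
Qed.

Lemma spectral_integral_cvg f : dom B f -> cut_op n f @[n --> \oo] --> B f.
Proof. by move=> df; apply/spectral_integral_domP. Qed.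

(** On a vector fixed by [E U] the truncated integrals are constant as soon as the truncating disc
    contains [U]. *)
Lemma spectral_integral_bounded (U : set R[i]) (r : R) f :
  borel U -> (forall z, U z -> nm z <= r) -> E U f = f ->
  dom B f /\ B f = calculus E (fun z => indic U z * z) f.
Proof.
move=> bU Ur EUf; apply/spectral_integral_domP; apply/cvgn_nmP => e e0.
have tU := totally_measurable_cut_id bU Ur.
exists (Num.truncn r).+1 => n rn.
have -> : cut_op n f = calculus E (fun z => indic U z * z) f.
  rewrite -{1}EUf -(calculus_indic hE bU) /cut_op -calculusM //; last 2 first.
  - exact: totally_measurable_cut_op.
  - exact: totally_measurable_indic.
  rewrite -[RHS]ES -(calculus_indic hE bS) -calculusM //; last first.
    exact: totally_measurable_indic.
  congr (calculus E _ f); apply/funext => z.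
  rewrite mulrAC indicM mulrA indicM; congr (indic _ z * z); apply/seteqP.
  rewrite cutoffE; split=> y; first by case=> -[].
  case=> Sy Uy; do 2!split => //=; apply: le_trans (Ur _ Uy) _.
  by apply: ltW (lt_le_trans (truncnS_gt _) _); rewrite ler_nat.
by rewrite subrr nm0 ltW.
Qed.

(** On the range of [E U] the difference from [lam] has symbol at most [e]. The constant depends on
    neither [lam] nor [U]. *)
Lemma spectral_integral_near_eigen : exists2 K : R, 0 < K &
  forall (lam : R[i]) (e : R) (U : set R[i]) f, borel U ->
    (forall z, U z -> nm (z - lam) <= e) -> E U f = f ->
    dom B f /\ nm (B f - lam *: f) <= K * e * nm f.
Proof.
have [K K0 KP] := is_calculus_bound hE; exists K => // lam e U f bU Ue EUf.
have Ur z : U z -> nm z <= nm lam + e.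
  by move=> /Ue; have := nmD lam (z - lam); rewrite addrC subrK; lra.
have [df ->] := spectral_integral_bounded bU Ur EUf; split => //.
have tU := totally_measurable_cut_id bU Ur.
have tU' := totally_measurable_indic bU; have tl := totally_measurable_cst lam.
rewrite -{2}EUf -(calculus_indic hE bU) -calculus_cst -calculusM // -calculusB //; last first.
  exact: totally_measurableM hE _ _ tl tU'.
have tD := totally_measurableB hE tU (totally_measurableM hE tl tU').
(* Off [U] the symbol is 0, so the bound needs [0 <= e]; a point of [U] gives this, and if [U] is
   empty then [f] is 0. *)
have [Uz|Uz] := pselect (U !=set0); last first.
  have f0 : f = 0.
    have U0 : U = set0 by apply/eqP/negPn/negP => /set0P.
    by rewrite -EUf U0 (spectral_set0 hE).
  by rewrite f0 (lin0 (calculus_lin hE tD)) nm0 mulr0.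
apply: KP (calculusP hE tD) _ => z; rewrite [lam * _]mulrC -mulrBr nmM /indic.
case: asboolP => [/Ue|_]; first by rewrite nm1 mul1r.
by rewrite nm0 mul0r; case: Uz => y /Ue; apply: le_trans; apply: nm_ge0.
Qed.

End SpectralIntegral.

(** * The complex exponential *)

Section ComplexExponential.
Variable R : realType.
Implicit Types (x y : R) (z w : R[i]).

Definition cexp z : R[i] :=
  (expR (complex.Re z))%:C * Complex (cos (complex.Im z)) (sin (complex.Im z)).

Lemma cexp0 : cexp 0 = 1.
Proof. by rewrite /cexp /= expR0 cos0 sin0 mul1r. Qed.

Lemma cexpD z w : cexp (z + w) = cexp z * cexp w.
Proof.
case: z w => [a b] [c d]; rewrite /cexp /= expRD cosD sinD rmorphM mulrACA.
by congr (_ * _); rewrite [sin b * _ + _]addrC.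
Qed.

Lemma nm_cexp z : nm (cexp z) = expR (complex.Re z).
Proof.
rewrite nmM nmR gtr0_norm ?expR_gt0 // /nm normc_def /=.
by rewrite cos2Dsin2 sqrtr1 mulr1.
Qed.

(** Writing the intermediate point as [th * y] treats both signs of [y], and [y = 0], in one
    statement. *)
Lemma mean_value0 (f df : R -> R) y :
  (forall x, is_derive x 1 f (df x)) ->
  exists2 th, 0 <= th <= 1 & f y - f 0 = df (th * y) * y.
Proof.
move=> fd; have cf (a b : R) : {within `[a, b], continuous f}.
  by apply: derivable_within_continuous => x _; apply: ex_derive.
have [y0|y0|->] := ltgtP y 0; last by exists 0; rewrite ?lexx ?ler01 // subrr mulr0.
- have [c] := MVT_segment (ltW y0) (fun x _ => fd x) (cf _ _).
  rewrite in_itv /= => /andP[yc c0] e; exists (c / y).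
    by rewrite mulr_le0 ?invr_le0 ?(ltW y0) //= ler_ndivrMr // mul1r.
  by rewrite divfK ?lt_eqF // -opprB e sub0r mulrN opprK.
- have [c] := MVT_segment (ltW y0) (fun x _ => fd x) (cf _ _).
  rewrite in_itv /= => /andP[c0 cy] e; exists (c / y).
    by rewrite divr_ge0 ?(ltW y0) //= ler_pdivrMr // mul1r.
  by rewrite divfK ?gt_eqF // e subr0.
Qed.

Let scale_le th y : 0 <= th <= 1 -> `|th * y| <= `|y|.
Proof.
by move=> /andP[t0 t1]; rewrite normrM (ger0_norm t0) ler_piMl.
Qed.

Lemma sin_abs_le y : `|sin y| <= `|y|.
Proof.
have [th _] := mean_value0 y (@is_derive_sin R); rewrite sin0 subr0 => ->.
by rewrite normrM ler_piMl // ler_norml cos_le1 cos_geN1.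
Qed.

Lemma cosB1_abs_le y : `|cos y - 1| <= y ^+ 2.
Proof.
have [th th01] := mean_value0 y (@is_derive_cos R); rewrite cos0 => ->.
rewrite normrM normrN -real_normK ?num_real // expr2 ler_wpM2r //.
exact: le_trans (sin_abs_le _) (scale_le _ th01).
Qed.

Lemma sinB_abs_le y : `|sin y - y| <= `|y| ^+ 3.
Proof.
have [th th01] := mean_value0 y (@is_derive_sin R); rewrite sin0 subr0 => ->.
rewrite -{3}[y]mul1r -mulrBl normrM exprSr ler_wpM2r //.
apply: le_trans (cosB1_abs_le _) _; rewrite -real_normK ?num_real //.
by rewrite lerXn2r ?nnegrE // scale_le.
Qed.

Lemma expRB1_abs_le x : `|expR x - 1| <= `|x| * expR (Num.max x 0).
Proof.
have [th th01] := mean_value0 x (@is_derive_expR R); rewrite expR0 => ->.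
rewrite normrM mulrC ler_wpM2l // ger0_norm ?expR_ge0 // ler_expR le_max.
case/andP: th01 => t0 t1; have [x0|/ltW x0] := lerP 0 x.
  by rewrite ler_piMl.
by rewrite mulr_ge0_le0 ?orbT.
Qed.

Lemma expRB1B_abs_le x : `|expR x - 1 - x| <= x ^+ 2 * expR `|x|.
Proof.
have [th th01] := mean_value0 x (@is_derive_expR R); rewrite expR0 => ->.
rewrite -{3}[x]mul1r -mulrBl normrM -real_normK ?num_real // expr2 -mulrA.
rewrite mulrC ler_wpM2l //; apply: le_trans (expRB1_abs_le _) _.
apply: ler_pM => //.
  exact: scale_le.
rewrite ler_expR ge_max normr_ge0 andbT.
exact: le_trans (ler_norm _) (scale_le _ th01).
Qed.

(** The exponential factor depends only on an upper bound [w] of the real part, so the estimate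
    survives on left half-planes; the factor [nm z] is what difference quotients divide out. In the
    3, one unit comes from [expR x - 1] and two from cosine and sine. *)
Lemma cexpB1_le z (w : R) : 0 <= w -> complex.Re z <= w ->
  nm (cexp z - 1) <= 3 * nm z * expR w.
Proof.
case: z => x y /= w0 xw; set z := Complex x y.
have xz : `|x| <= nm z by apply: (nm_ge_Re z).
have yz : `|y| <= nm z by apply: (nm_ge_Im z).
have ew : 0 < expR w by apply: expR_gt0.
have ex : expR x <= expR w by rewrite ler_expR.
have -> : cexp z - 1 = (expR x)%:C * (Complex (cos y) (sin y) - 1) +
    (expR x - 1)%:C.
  by rewrite /cexp /= rmorphB /=; ring.
apply: le_trans (nmD _ _) _; rewrite nmM !nmR (ger0_norm (expR_ge0 _)).
have e1 : `|expR x - 1| <= nm z * expR w.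
  apply: le_trans (expRB1_abs_le _) _; apply: ler_pM => //.
  by rewrite ler_expR ge_max xw.
have : nm (Complex (cos y) (sin y) - 1) <= 2 * nm z.
  apply: le_trans (nm_le_ReIm _) _; rewrite /= subr0.
  have := sin_abs_le y.
  have : `|cos y - 1| <= `|y|.
    have [th _] := mean_value0 y (@is_derive_cos R); rewrite cos0 => ->.
    by rewrite normrM ler_piMl // normrN ler_norml sin_le1 sin_geN1.
  lra.
move=> /(ler_wpM2l (expR_ge0 x)) e2.
have e3 : expR x * (2 * nm z) <= expR w * (2 * nm z).
  by rewrite ler_wpM2r // mulr_ge0 // nm_ge0.
lra.
Qed.

Lemma cexpB1B_le z : nm (cexp z - 1 - z) <= nm z ^+ 2 * ((3 + nm z) * expR (nm z)).
Proof.
case: z => x y; set z := Complex x y.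
have xz : `|x| <= nm z by apply: (nm_ge_Re z).
have yz : `|y| <= nm z by apply: (nm_ge_Im z).
set r := nm z in xz yz *; have r0 : 0 <= r by apply: nm_ge0.
have exr : expR `|x| <= expR r by rewrite ler_expR.
have ex : expR x <= expR r.
  by rewrite ler_expR; apply: le_trans (ler_norm _) _.
have y2 : y ^+ 2 <= r ^+ 2 by rewrite -real_normK ?num_real // lerXn2r ?nnegrE.
have x2 : x ^+ 2 <= r ^+ 2 by rewrite -real_normK ?num_real // lerXn2r ?nnegrE.
apply: le_trans (nm_le_ReIm _) _; rewrite /z /cexp /= !(mul0r, addr0, subr0, oppr0).
have -> : expR x * cos y - 1 - x = expR x * (cos y - 1) + (expR x - 1 - x) by ring.
have -> : expR x * sin y - y = expR x * (sin y - y) + (expR x - 1) * y by ring.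
have h1 : `|expR x * (cos y - 1)| <= expR r * r ^+ 2.
  rewrite normrM ger0_norm ?expR_ge0 //; apply: ler_pM => //.
  exact: le_trans (cosB1_abs_le _) _.
have h2 : `|expR x - 1 - x| <= r ^+ 2 * expR r.
  apply: le_trans (expRB1B_abs_le _) _; apply: ler_pM => //; exact: sqr_ge0.
have h3 : `|expR x * (sin y - y)| <= expR r * r ^+ 3.
  rewrite normrM ger0_norm ?expR_ge0 //; apply: ler_pM => //.
  by apply: le_trans (sinB_abs_le _) _; rewrite lerXn2r ?nnegrE.
have h4 : `|(expR x - 1) * y| <= r * expR r * r.
  rewrite normrM; apply: ler_pM => //; apply: le_trans (expRB1_abs_le _) _.
  apply: ler_pM => //.
  by rewrite ler_expR ge_max r0 andbT; apply: le_trans (ler_norm _) _.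
have := ler_normD (expR x * (cos y - 1)) (expR x - 1 - x).
have := ler_normD (expR x * (sin y - y)) ((expR x - 1) * y).
have -> : r ^+ 2 * ((3 + r) * expR r) =
  expR r * r ^+ 2 + r ^+ 2 * expR r + expR r * r ^+ 3 + r * expR r * r by ring.
lra.
Qed.

Lemma cexp_real (t : R) z : complex.Re (t%:C * z) = t * complex.Re z.
Proof. by case: z => a b /=; rewrite mul0r subr0. Qed.

Lemma nm_cexpM (t : R) z : nm (cexp (t%:C * z)) = expR (t * complex.Re z).
Proof. by rewrite nm_cexp cexp_real. Qed.

Lemma continuous_cexp : continuous cexp.
Proof.
move=> z; apply/(@cvg_nmP _ _ _ (nbhs z)) => e e0.
pose C := 3 * expR 1 * expR (complex.Re z).
have C0 : 0 < C by rewrite !mulr_gt0 ?expR_gt0.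
have d0 : 0 < Num.min 1 (e / C) by rewrite lt_min ltr01 divr_gt0.
apply: filterS (nm_near z d0) => w zw.
have zw1 : nm (z - w) <= 1 by apply: le_trans zw _; rewrite ge_min lexx.
have zwe : nm (z - w) <= e / C by apply: le_trans zw _; rewrite ge_min lexx orbT.
have -> : cexp z - cexp w = - (cexp z * (cexp (w - z) - 1)).
  by rewrite mulrBr -cexpD [z + _]addrC subrK mulr1 opprB.
rewrite nmN nmM nm_cexp; have wz : complex.Re (w - z) <= 1.
  by apply: le_trans (ler_norm _) (le_trans (nm_ge_Re _) _); rewrite nm_distC.
have := cexpB1_le ler01 wz.
move=> /(ler_wpM2l (expR_ge0 (complex.Re z))) /le_trans; apply.
have wz' : nm (w - z) * C <= e by rewrite -ler_pdivlMr // nm_distC.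
by move: wz'; rewrite /C; lra.
Qed.

End ComplexExponential.

(** * Strongly continuous semigroups *)

Section SemigroupTheory.
Variables (R : realType) (X : completeNormedModType R[i]).

Lemma near_at_right0P (P : R -> Prop) :
  (\forall t \near 0^'+, P t) <->
  exists2 d : R, 0 < d & forall t, 0 < t -> t <= d -> P t.
Proof.
split=> [[d /= d0 dP]|[d d0 dP]].
  exists (d / 2) => [|t t0 td]; first by rewrite divr_gt0.
  apply: dP => //=; rewrite sub0r normrN gtr0_norm //.
  by apply: le_lt_trans td _; rewrite ltr_pdivrMr // ltr_pMr // ltr1n.
exists d => // t /=; rewrite sub0r normrN => td t0; apply: dP => //.
exact: le_trans (ler_norm _) (ltW td).
Qed.

Lemma div_natr_small (t d : R) : 0 < d ->
  exists N, forall n, (N <= n)%N -> t / n.+1%:R <= d.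
Proof.
move=> d0; exists (Num.truncn (t / d)) => n Nn.
rewrite ler_pdivrMr // mulrC -ler_pdivrMr //.
by apply: ltW (lt_le_trans (truncnS_gt _) _); rewrite ler_nat.
Qed.

Section OneSemigroup.
Variable T : R -> X -> X.
Hypothesis sgT : C0_semigroup T.

Lemma semigroup_lin t : 0 <= t -> linear (T t).
Proof. by move=> t0; apply: bounded_lin; apply: semigroup_bounded sgT _ t0. Qed.

Lemma semigroupDE s t f : 0 <= s -> 0 <= t -> T (s + t) f = T s (T t f).
Proof. by move=> s0 t0; rewrite (semigroupD sgT). Qed.

Lemma semigroup_mulS n h f : 0 <= h -> T (n.+1%:R * h) f = T (n%:R * h) (T h f).
Proof. by move=> h0; rewrite -natr1 mulrDl mul1r semigroupDE // mulr_ge0. Qed.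

Lemma semigroup_small f (e : R) : 0 < e ->
  exists2 d : R, 0 < d & forall t, 0 < t -> t <= d -> nm (T t f - f) <= e.
Proof.
move=> e0; have /cvg_nmP/(_ _ e0) := @semigroup_cvg0 _ _ _ sgT f.
by move=> /near_at_right0P[d d0 dP]; exists d => // t t0 /(dP _ t0); rewrite nm_distC.
Qed.

(** Otherwise there are times [s n] tending to 0 with [T (s n)] of norm above n. Each orbit
    converges along these times, so the operators are bounded at every vector, against
    Banach-Steinhaus. *)
Lemma semigroup_locally_bounded : exists2 d : R, 0 < d &
  exists2 K : R, 0 <= K & forall s f, 0 <= s -> s <= d -> nm (T s f) <= K * nm f.
Proof.
apply: contrapT => H.
have /choice[s sP] : forall n, exists s : R, [/\ 0 <= s, s <= n.+1%:R^-1 &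
    exists f, n%:R * nm f < nm (T s f)].
  move=> n; apply: contrapT => H'; apply: H; exists (n.+1%:R^-1).
    by rewrite invr_gt0.
  exists n%:R => // s f s0 sn; rewrite leNgt; apply/negP => lt.
  by apply: H'; exists s; split=> //; exists f.
have bT n : bounded_operator (T (s n)).
  by apply: semigroup_bounded sgT _ _; have [] := sP n.
have [f|K K0 KP] := uniform_boundedness bT.
  have [d d0 dP] := semigroup_small f ltr01.
  have [N NP] := div_natr_small 1 d0.
  (* The sum covers the finitely many early indices; later ones have [s n <= d], where the orbit is
     within 1 of [f]. *)
  exists (nm f + 1 + \sum_(k < N) nm (T (s k) f)) => n.
  have [s0 sn _] := sP n.
  have S0 : 0 <= \sum_(k < N) nm (T (s k) f) by rewrite sumr_ge0 // => k _; apply: nm_ge0.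
  have [nN|Nn] := ltnP n N.
    rewrite (bigD1 (Ordinal nN)) //=.
    have := @sumr_ge0 R _ (index_enum 'I_N) (fun k => k != Ordinal nN)
      (fun k => nm (T (s k) f)) (fun k _ => nm_ge0 _).
    by have := nm_ge0 f; lra.
  have [s00|s00] := eqVneq (s n) 0.
    by rewrite s00 (semigroup0 sgT); lra.
  have spos : 0 < s n by rewrite lt_def s00.
  have sd : s n <= d by apply: le_trans sn _; have := NP _ Nn; rewrite mul1r.
  by have := dP _ spos sd; have := nm_lerB (T (s n) f) f; lra.
have [_ _ [f]] := sP (Num.truncn K).+1; have := KP (Num.truncn K).+1 f.
have := ler_wpM2r (nm_ge0 f) (ltW (truncnS_gt K)); lra.
Qed.

Lemma semigroup_iter_le n (h K : R) f : 0 <= h -> 0 <= K ->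
  (forall g, nm (T h g) <= K * nm g) -> nm (T (n%:R * h) f) <= K ^+ n * nm f.
Proof.
move=> h0 K0 hK; elim: n f => [|n IHn] f.
  by rewrite mul0r (semigroup0 sgT) expr0 mul1r.
rewrite semigroup_mulS // exprSr -mulrA; apply: le_trans (IHn _) _.
by rewrite ler_wpM2l // exprn_ge0.
Qed.

Lemma semigroup_bounded_on (t : R) :
  exists2 K : R, 1 <= K & forall s f, 0 <= s -> s <= t -> nm (T s f) <= K * nm f.
Proof.
have [d d0 [K K0 KP]] := semigroup_locally_bounded.
have [N /(_ _ (leqnn N)) Nd] := div_natr_small t d0.
pose K1 := Num.max 1 K; have K11 : 1 <= K1 by rewrite le_max lexx.
have KP1 s f : 0 <= s -> s <= d -> nm (T s f) <= K1 * nm f.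
  move=> s0 sd; apply: le_trans (KP s f s0 sd) _.
  by rewrite ler_wpM2r ?nm_ge0 // le_max lexx orbT.
exists (K1 ^+ N.+1) => [|s f s0 st]; first exact: exprn_ege1.
pose h := s / N.+1%:R; have h0 : 0 <= h by rewrite divr_ge0.
have hd : h <= d by apply: le_trans Nd; rewrite ler_wpM2r // invr_ge0.
have -> : s = N.+1%:R * h by rewrite mulrC divfK.
apply: semigroup_iter_le => // [|g]; last exact: KP1.
exact: le_trans K11.
Qed.

(** Domain and value in one statement with the denominator cleared, the form in which steps can be
    summed. *)
Lemma generatorP f g : (dom (generator T) f /\ generator T f = g) <->
  forall e : R, 0 < e -> exists2 d : R, 0 < d &
    forall t, 0 < t -> t <= d -> nm (T t f - f - t%:C *: g) <= e * t.
Proof.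
have qE (t : R) : 0 < t ->
    nm (g - (t^-1)%:C *: (T t f - f)) = nm (T t f - f - t%:C *: g) / t.
  move=> t0; rewrite nm_distC.
  have -> : (t^-1)%:C *: (T t f - f) - g = (t^-1)%:C *: (T t f - f - t%:C *: g).
    by rewrite [in RHS]scalerBr scalerA -rmorphM mulVf ?gt_eqF // scale1r.
  by rewrite nmZ nmR gtr0_norm ?invr_gt0 // mulrC.
have -> : (dom (generator T) f /\ generator T f = g) <->
    (t^-1)%:C *: (T t f - f) @[t --> 0^'+] --> g.
  by split=> [[df <-]|fg]; [exact: df|split; [apply/cvg_ex; exists g|apply/cvg_lim]].
rewrite cvg_nmP; split=> H e e0.
  have /near_at_right0P[d d0 dP] := H _ e0; exists d => // t t0 td.
  by rewrite -ler_pdivrMr // -qE // dP.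
apply/near_at_right0P; have [d d0 dP] := H _ e0; exists d => // t t0 td.
by rewrite qE // ler_pdivrMr // dP.
Qed.

Lemma generator_semigroup s f : 0 <= s -> dom (generator T) f ->
  dom (generator T) (T s f) /\ generator T (T s f) = T s (generator T f).
Proof.
move=> s0 df; apply/generatorP => e e0.
have [K K1 KP] := semigroup_bounded_on s.
have K0 : 0 < K by apply: lt_le_trans K1.
have e0' : 0 < e / K by rewrite divr_gt0.
have /generatorP/(_ _ e0')[d d0 dP] := conj df (erefl (generator T f)).
exists d => // t t0 td; have lT := semigroup_lin s0.
rewrite -(semigroupDE f (ltW t0) s0) [t + s]addrC (semigroupDE f s0 (ltW t0)).
rewrite -(linZ lT) -!(linB lT); apply: le_trans (KP _ _ s0 (lexx _)) _.
rewrite -ler_pdivlMl // mulrA [K^-1 * e]mulrC; exact: dP.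
Qed.

(** The noncommutative factorization of a difference of N-th powers, applied to [T h] and [mu]. *)
Lemma semigroup_telescope (f : X) (mu : R[i]) (h K L : R) (N : nat) :
  0 <= h -> 0 <= K -> 0 <= L ->
  (forall k g, (k <= N)%N -> nm (T (k%:R * h) g) <= K * nm g) ->
  (forall k, (k <= N)%N -> nm (mu ^+ k) <= L) ->
  nm (T (N%:R * h) f - mu ^+ N *: f) <= N%:R * (L * K * nm (T h f - mu *: f)).
Proof.
move=> h0 K0 L0 TK muL.
(* The factor [mu ^+ j] is carried along so that powers of [mu] are estimated once by [L], instead
   of multiplying a bound at every step. *)
suff H n j : (j + n <= N)%N -> nm (mu ^+ j *: (T (n%:R * h) f - mu ^+ n *: f)) <=
    n%:R * (L * K * nm (T h f - mu *: f)).
  by have := H N 0%N; rewrite scale1r; apply.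
elim: n j => [|n IHn] j jn.
  by rewrite mul0r (semigroup0 sgT) scale1r subrr scaler0 nm0 mul0r.
have lT := semigroup_lin (mulr_ge0 (ler0n R n) h0).
have -> : T (n.+1%:R * h) f - mu ^+ n.+1 *: f =
    T (n%:R * h) (T h f - mu *: f) + mu *: (T (n%:R * h) f - mu ^+ n *: f).
  rewrite semigroup_mulS // (linB lT) (linZ lT) scalerBr scalerA -exprS.
  by rewrite addrA subrK.
rewrite scalerDr scalerA -exprSr; apply: le_trans (nmD _ _) _.
rewrite -natr1 mulrDl addrC mul1r; apply: lerD.
  by apply: IHn; rewrite addSn -addnS.
rewrite nmZ -mulrA; apply: ler_pM; [exact: nm_ge0|exact: nm_ge0| |].
  by apply: muL; apply: leq_trans jn; rewrite leq_addr.
by apply: TK; apply: leq_trans jn; rewrite addnS ltnW // ltnS leq_addl.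
Qed.

(** A discrete form of writing T t f - exp (t lam) f as the integral over [0, t] of exp ((t - s)
    lam) T s (A f - lam f). The case [lam = 0] is a mean value inequality for orbits. *)
Lemma semigroup_near_eigen (t K : R) (lam : R[i]) f : 0 <= t -> 0 <= K ->
  (forall s g, 0 <= s -> s <= t -> nm (T s g) <= K * nm g) ->
  dom (generator T) f ->
  nm (T t f - cexp (t%:C * lam) *: f) <=
    t * (expR (t * nm lam) * K * nm (generator T f - lam *: f)).
Proof.
move=> t0 K0 TK df; set L := expR (t * nm lam); set g := generator T f.
have L0 : 0 <= L by apply: expR_ge0.
move: t0; rewrite le_eqVlt => /predU1P[t0|t0].
  by rewrite -t0 (semigroup0 sgT) mul0r cexp0 scale1r subrr nm0 mul0r.
apply/ler_addgt0Pr => e e0.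
(* Each step of length [h] costs an extra [d * h * (1 + nm f)]: one part from the generator, one
   from the exponential. Telescoped, and with 1 added for positivity, this is at most
   [d * D = e]. *)
pose D := t * (L * K * (1 + nm f)) + 1.
have D0 : 0 < D by rewrite ltr_wpDl // !mulr_ge0 ?(ltW t0) // addr_ge0 // nm_ge0.
have d0 : 0 < e / D by rewrite divr_gt0.
have eD : e = e / D * D by rewrite divfK // gt_eqF.
set d := e / D in d0 eD; clearbody d.
have /generatorP/(_ _ d0)[d1 d10 d1P] := conj df (erefl g).
pose Q := (3 + t * nm lam) * expR (t * nm lam).
have Q0 : 0 <= Q.
  by rewrite mulr_ge0 ?expR_ge0 // addr_ge0 // mulr_ge0 ?nm_ge0 // ltW.
(* [h * M <= d] makes the second-order remainder of exp (h lam) at most [d * h]. *)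
pose M := nm lam ^+ 2 * Q + 1.
have M0 : 0 < M by rewrite ltr_wpDl // mulr_ge0 ?sqr_ge0.
have d20 : 0 < d / M by rewrite divr_gt0.
have [N1 N1P] := div_natr_small t d10; have [N2 N2P] := div_natr_small t d20.
pose N := maxn N1 N2; pose h := t / N.+1%:R.
have h0 : 0 < h by rewrite divr_gt0.
have ht : h <= t by rewrite ler_pdivrMr // ler_peMr ?(ltW t0) // ler1n.
have hN : N.+1%:R * h = t by rewrite mulrC divfK.
have b1 : nm (T h f - f - h%:C *: g) <= d * h.
  by apply: d1P => //; apply: N1P; apply: leq_maxl.
have hM : h * M <= d by rewrite -ler_pdivlMr //; apply: N2P; apply: leq_maxr.
clearbody h.
pose mu := cexp (h%:C * lam).
have nhl : nm (h%:C * lam) = h * nm lam by rewrite nmM nmR gtr0_norm.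
have b2 : nm (mu - 1 - h%:C * lam) <= d * h.
  apply: le_trans (cexpB1B_le _) _; rewrite nhl.
  have hl : h * nm lam <= t * nm lam by rewrite ler_wpM2r // nm_ge0.
  have hl0 : 0 <= h * nm lam by rewrite mulr_ge0 ?nm_ge0 // ltW.
  have : (3 + h * nm lam) * expR (h * nm lam) <= Q.
    by apply: ler_pM; rewrite ?expR_ge0 ?ler_expR ?lerD2l // addr_ge0.
  have h2 : 0 <= (h * nm lam) ^+ 2 by apply: sqr_ge0.
  move=> /(ler_wpM2l h2) /le_trans; apply.
  have := ler_wpM2r (ltW h0) hM; rewrite /M; have := mulr_gt0 h0 h0; lra.
have muk k : (k <= N.+1)%N -> nm (mu ^+ k) <= L.
  move=> kN; have -> : nm (mu ^+ k) = nm mu ^+ k.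
    by elim: k {kN} => [|k IHk]; rewrite ?nm1 // exprS nmM IHk -exprS.
  rewrite nm_cexpM -expRM_natl ler_expR mulrA mulrC [leRHS]mulrC.
  apply: le_trans (_ : nm lam * (k%:R * h) <= _).
    rewrite ler_wpM2r ?mulr_ge0 ?(ltW h0) //.
    by apply: le_trans (ler_norm _) (nm_ge_Re _).
  by rewrite ler_wpM2l ?nm_ge0 // -hN ler_wpM2r ?(ltW h0) // ler_nat.
have TKh k x : (k <= N.+1)%N -> nm (T (k%:R * h) x) <= K * nm x.
  move=> kN; apply: TK; first by rewrite mulr_ge0 // ltW.
  by rewrite -hN ler_wpM2r ?(ltW h0) // ler_nat.
have := @semigroup_telescope f mu h K L N.+1 (ltW h0) K0 L0 TKh muk.
have -> : mu ^+ N.+1 = cexp (t%:C * lam).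
  rewrite -hN; elim: N.+1 => [|n IHn]; first by rewrite mul0r mul0r cexp0.
  by rewrite exprSr IHn -cexpD -mulrDl -rmorphD -natr1 mulrDl mul1r.
rewrite hN mulrA => /le_trans; apply.
have b3 : nm (T h f - mu *: f) <= h * (nm (g - lam *: f) + d * (1 + nm f)).
  have -> : T h f - mu *: f = (T h f - f - h%:C *: g) + h%:C *: (g - lam *: f)
      - (mu - 1 - h%:C * lam) *: f.
    rewrite !scalerBl scalerBr scalerA scale1r addrA subrK.
    by rewrite subrACA subrr subr0 subrACA subrr subr0.
  apply: le_trans (nmB _ _) _; have := nmD (T h f - f - h%:C *: g) (h%:C *: (g - lam *: f)).
  rewrite !nmZ nmR gtr0_norm //.
  have := ler_wpM2r (nm_ge0 f) b2; lra.
have LK : 0 <= N.+1%:R * (L * K) by rewrite !mulr_ge0.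
have -> : t * (L * K * nm (g - lam *: f)) + e =
    N.+1%:R * (L * K) * (h * (nm (g - lam *: f) + d * (1 + nm f))) + d.
  by rewrite eD /D -hN; ring.
by apply: ler_wpDr; [apply: ltW|apply: ler_wpM2l].
Qed.

End OneSemigroup.
End SemigroupTheory.

Lemma addr_telescope (V : zmodType) (a b c l f m : V) :
  (a - b - c) + (c - l) + (b - f - m) = a - f - (m + l).
Proof.
rewrite [a - b - c + _]addrA subrK addrAC [a - b + _]addrA subrKA opprD.
by rewrite addrA.
Qed.

(** * Uniqueness of the semigroup with a given generator *)

Section SemigroupUniqueness.
Variables (R : realType) (X : completeNormedModType R[i]).

(** Taylor expansion by summing short steps, where the drift of [T s g] from [g] is at most
    [t * (K * nm u)]. The cruder factor [t ^+ 2] without one half is enough for an error of order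
    two. *)
Lemma semigroup_second_order (T : R -> X -> X) (t K : R) f :
  C0_semigroup T -> 0 <= t -> 0 <= K ->
  (forall s g, 0 <= s -> s <= t -> nm (T s g) <= K * nm g) ->
  dom (generator T) f -> dom (generator T) (generator T f) ->
  nm (T t f - f - t%:C *: generator T f) <=
    t ^+ 2 * (K * nm (generator T (generator T f))).
Proof.
move=> sgT t0 K0 TK df; set g := generator T f => dg; set u := generator T g.
have Tg s : 0 <= s -> s <= t -> nm (T s g - g) <= s * (K * nm u).
  move=> s0 st; have TK' r x : 0 <= r -> r <= s -> nm (T r x) <= K * nm x.
    by move=> r0 rs; apply: TK => //; apply: le_trans st.
  have := semigroup_near_eigen sgT 0 s0 K0 TK' dg.
  by rewrite mulr0 cexp0 scale1r nm0 mulr0 expR0 mul1r scale0r subr0.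
move: t0; rewrite le_eqVlt => /predU1P[t0|t0].
  by rewrite -t0 (semigroup0 sgT) scale0r subr0 subrr nm0 expr2 !mul0r.
have iter n h : 0 <= h -> n%:R * h <= t ->
    nm (T (n%:R * h) f - f - (n%:R * h)%:C *: g) <=
    n%:R * (K * nm (T h f - f - h%:C *: g) + h * (t * (K * nm u))).
  move=> h0; elim: n => [_|n IHn nt].
    by rewrite mul0r (semigroup0 sgT) scale0r subr0 subrr nm0 mul0r.
  have nh0 : 0 <= n%:R * h by rewrite mulr_ge0.
  have nht : n%:R * h <= t by apply: le_trans nt; rewrite ler_wpM2r // ler_nat.
  have lT := semigroup_lin sgT nh0.
  have -> : T (n.+1%:R * h) f - f - (n.+1%:R * h)%:C *: g =
      T (n%:R * h) (T h f - f - h%:C *: g) + h%:C *: (T (n%:R * h) g - g)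
      + (T (n%:R * h) f - f - (n%:R * h)%:C *: g).
    rewrite (semigroup_mulS sgT) // !(linB lT) (linZ lT) scalerBr addr_telescope.
    by rewrite -natr1 mulrDl mul1r rmorphD scalerDl.
  apply: le_trans (nmD _ _) _; rewrite -natr1 mulrDl addrC mul1r.
  apply: lerD; first exact: IHn.
  apply: le_trans (nmD _ _) _; apply: lerD; first exact: TK.
  rewrite nmZ nmR ger0_norm //; apply: ler_wpM2l => //.
  apply: le_trans (Tg _ nh0 nht) _; apply: ler_wpM2r => //.
  by rewrite mulr_ge0 // nm_ge0.
apply/ler_addgt0Pr => e e0.
have D0 : 0 < K * t + 1 by rewrite ltr_wpDl // mulr_ge0 // ltW.
have d0 : 0 < e / (K * t + 1) by rewrite divr_gt0.
have eD : e = e / (K * t + 1) * (K * t + 1) by rewrite divfK // gt_eqF.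
set d := e / _ in d0 eD; clearbody d.
have /(generatorP T)/(_ _ d0)[d1 d10 d1P] := conj df (erefl g).
have [N /(_ _ (leqnn N)) Nd] := div_natr_small t d10.
have hN : N.+1%:R * (t / N.+1%:R) = t by rewrite mulrC divfK.
have h0 : 0 < t / N.+1%:R by rewrite divr_gt0.
have dh := d1P _ h0 Nd; set h := t / _ in hN h0 dh; clearbody h.
have := iter N.+1 h (ltW h0); rewrite hN => /(_ (lexx _)) /le_trans; apply.
apply: le_trans (_ : N.+1%:R * (K * (d * h) + h * (t * (K * nm u))) <= _).
  by rewrite ler_wpM2l // lerD2r ler_wpM2l.
have -> : N.+1%:R * (K * (d * h) + h * (t * (K * nm u))) =
    d * (K * (N.+1%:R * h)) + (N.+1%:R * h) * t * (K * nm u) by ring.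
by rewrite hN eD -expr2 addrC lerD2l ler_wpM2l ?(ltW d0) // lerDl.
Qed.

Lemma generatesE (A : operator X) (T : R -> X -> X) f : generates A T -> dom A f ->
  dom (generator T) f /\ generator T f = A f.
Proof. by move=> [dA eA] df; rewrite -dA eA. Qed.

Lemma generates_semigroup (A : operator X) (T : R -> X -> X) s f :
  C0_semigroup T -> generates A T -> 0 <= s -> dom A f ->
  dom A (T s f) /\ A (T s f) = T s (A f).
Proof.
move=> sgT gA s0 df; have [dT eT] := generatesE gA df.
have [dsT esT] := generator_semigroup sgT s0 dT.
have dAs : dom A (T s f) by rewrite gA.1.
by split=> //; rewrite gA.2 // esT eT.
Qed.

(* On the domain of A^2 the two semigroups agree on a step of length t / n up to
   O(n^-2), so that the n errors telescope to O(n^-1). *)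
Lemma semigroup_unique_dom2 (A : operator X) (T U : R -> X -> X) t f :
  C0_semigroup T -> C0_semigroup U -> generates A T -> generates A U ->
  0 <= t -> dom A f -> dom A (A f) -> T t f = U t f.
Proof.
move=> sgT sgU gT gU t0 df dAf.
have [K1 K11 K1P] := semigroup_bounded_on sgT t.
have [K2 K21 K2P] := semigroup_bounded_on sgU t.
pose K := Num.max K1 K2.
have K0 : 0 <= K by rewrite le_max (le_trans ler01 K11).
have KT s g : 0 <= s -> s <= t -> nm (T s g) <= K * nm g.
  move=> s0 st; apply: le_trans (K1P _ _ s0 st) _.
  by rewrite ler_wpM2r ?nm_ge0 // le_max lexx.
have KU s g : 0 <= s -> s <= t -> nm (U s g) <= K * nm g.
  move=> s0 st; apply: le_trans (K2P _ _ s0 st) _.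
  by rewrite ler_wpM2r ?nm_ge0 // le_max lexx orbT.
have one s g : 0 <= s -> s <= t -> dom A g -> dom A (A g) ->
    nm (T s g - U s g) <= 2 * s ^+ 2 * (K * nm (A (A g))).
  move=> s0 st dg dAg.
  have [dT eT] := generatesE gT dg; have [dT' eT'] := generatesE gT dAg.
  have [dU eU] := generatesE gU dg; have [dU' eU'] := generatesE gU dAg.
  have dTT : dom (generator T) (generator T g) by rewrite eT.
  have dUU : dom (generator U) (generator U g) by rewrite eU.
  have := semigroup_second_order sgT s0 K0
    (fun r x r0 rs => KT r x r0 (le_trans rs st)) dT dTT.
  have := semigroup_second_order sgU s0 K0
    (fun r x r0 rs => KU r x r0 (le_trans rs st)) dU dUU.
  rewrite eT eU eT' eU'.
  have -> : T s g - U s g = (T s g - g - s%:C *: A g) - (U s g - g - s%:C *: A g).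
    by rewrite subrACA subrr subr0 subrACA subrr subr0.
  have := nmB (T s g - g - s%:C *: A g) (U s g - g - s%:C *: A g); lra.
(* Carrying [T (j h)] outside the difference uses the bound [K] once per error term rather than
   compounding it. The other [K] is uniform because [U] commutes with the square of [A]. *)
have iter (h : R) m j : 0 <= h -> (j + m)%:R * h <= t ->
    nm (T (j%:R * h) (T (m%:R * h) f - U (m%:R * h) f)) <=
    m%:R * (K * (2 * h ^+ 2 * (K * (K * nm (A (A f)))))).
  move=> h0; elim: m j => [|m IHm] j jm.
    rewrite mul0r (semigroup0 sgT) (semigroup0 sgU) subrr.
    by rewrite (lin0 (semigroup_lin sgT _)) ?mulr_ge0 // nm0 mul0r.
  have jh0 : 0 <= j%:R * h by rewrite mulr_ge0.
  have mh0 : 0 <= m%:R * h by rewrite mulr_ge0.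
  have jt : j%:R * h <= t.
    by apply: le_trans jm; rewrite ler_wpM2r // ler_nat leq_addr.
  have mt : m%:R * h <= t.
    apply: le_trans jm; rewrite ler_wpM2r // ler_nat.
    by rewrite addnS ltnW // ltnS leq_addl.
  have ht : h <= t.
    by apply: le_trans jm; rewrite addnS ler_peMl // ler1n.
  have lT := semigroup_lin sgT jh0.
  have mulSr V : C0_semigroup V -> V (m.+1%:R * h) f = V h (V (m%:R * h) f).
    move=> sgV; rewrite -(semigroupDE sgV) //; congr (V _ f).
    by rewrite -natr1 mulrDl mul1r addrC.
  have [dg Ag] := generates_semigroup sgU gU mh0 df.
  have [dAg AAg] := generates_semigroup sgU gU mh0 dAf.
  rewrite (mulSr T) // (mulSr U) //; set g := U _ f in dg Ag *.
  have -> : T h (T (m%:R * h) f) - U h g =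
      T h (T (m%:R * h) f - g) + (T h g - U h g).
    by rewrite (linB (semigroup_lin sgT h0)) addrA subrK.
  rewrite (linD lT) -(semigroup_mulS sgT) //; apply: le_trans (nmD _ _) _.
  rewrite -[m.+1%:R]natr1 mulrDl mul1r; apply: lerD.
    by apply: IHm; rewrite addSn -addnS.
  apply: le_trans (KT _ _ jh0 jt) _; apply: ler_wpM2l => //.
  have := one h g h0 ht dg; rewrite Ag AAg => /(_ dAg) /le_trans; apply.
  apply: ler_wpM2l; first by rewrite mulr_ge0 // sqr_ge0.
  by apply: ler_wpM2l => //; apply: KU.
apply/eqP; rewrite -subr_eq0; apply/eqP; apply: nm_le_eq0 => e e0.
pose C := 2 * t * (K * (K * (K * nm (A (A f))))).
have C0 : 0 <= C.
  by apply: mulr_ge0; [lra|do 3!apply: mulr_ge0 => //; apply: nm_ge0].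
have d0 : 0 < e / (C + 1) by rewrite divr_gt0 // ltr_wpDl.
have [N /(_ _ (leqnn N)) Nd] := div_natr_small t d0.
have hN : N.+1%:R * (t / N.+1%:R) = t by rewrite mulrC divfK.
have h0 : 0 <= t / N.+1%:R by rewrite divr_ge0.
set h := t / _ in hN h0 Nd; clearbody h.
have := iter h N.+1 0%N h0; rewrite add0n hN lexx mul0r (semigroup0 sgT).
move=> /(_ isT) /le_trans; apply.
have -> : N.+1%:R * (K * (2 * h ^+ 2 * (K * (K * nm (A (A f)))))) = C * h.
  by rewrite /C -[in RHS]hN; ring.
have : (C + 1) * h <= e by rewrite mulrC -ler_pdivlMr // ltr_wpDl.
lra.
Qed.

Lemma dense_bounded_eq (D : set X) (S S' : X -> X) :
  bounded_operator S -> bounded_operator S' ->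
  (forall f (e : R), 0 < e -> exists2 g, D g & nm (f - g) <= e) ->
  (forall g, D g -> S g = S' g) -> S = S'.
Proof.
move=> /bounded_operatorP[lS [C C0 SC]] /bounded_operatorP[lS' [C' C'0 SC']] dD eS.
apply/funext => f; apply/eqP; rewrite -subr_eq0; apply/eqP; apply: nm_le_eq0 => e e0.
have d0 : 0 < e / (C + C' + 1) by rewrite divr_gt0 // ltr_wpDl // addr_ge0.
have [g Dg fg] := dD f _ d0.
have -> : S f - S' f = S (f - g) - S' (f - g).
  by rewrite (linB lS) (linB lS') (eS g Dg) subrACA subrr subr0.
apply: le_trans (nmB _ _) _; have := SC (f - g); have := SC' (f - g).
move: fg; rewrite ler_pdivlMr ?ltr_wpDl ?addr_ge0 //; have := nm_ge0 (f - g); lra.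
Qed.

End SemigroupUniqueness.

(** * Norm continuity bounds the spectrum in right half-planes *)

Section NormContinuousImpliesBounded.
Variables (R : realType) (X : completeNormedModType R[i]).

Lemma bounded_set_nmP (A : set R[i]) :
  bounded_set A <-> exists C : R, forall z, A z -> nm z <= C.
Proof.
split=> [[M [/complex_realP[m ->] Mb]]|[C AC]].
  exists (m + 1) => z Az; rewrite -lecR -nmE; apply: (Mb _ _ z Az).
  by rewrite ltcR ltrDl.
exists C%:C; split=> [|M CM z Az]; first by apply/complex_realP; exists C.
by apply: le_trans (ltW CM); rewrite nmE lecR AC.
Qed.

Variable E : set R[i] -> X -> X.
Hypothesis hE : spectral_measure E.
Let S := spectral_support E.
Let bS : borel S := borel_spectral_support E.
Let ES f : E S f = f := spectral_support_id hE f.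

Lemma spectral_support_near_eigen (lam : R[i]) (e : R) : S lam -> 0 < e ->
  exists U f, [/\ borel U, forall z, U z -> nm (z - lam) <= e, E U f = f & f != 0].
Proof.
move=> Sl e0; have oU : open (ball lam e%:C) by apply: ball_open; rewrite ltcR.
have bU := borel_open oU.
have Ul : ball lam e%:C lam by apply: ballxx; rewrite ltcR.
have [g gU] : exists g, E (ball lam e%:C) g != 0.
  apply: contrapT => H; apply: (Sl _ oU Ul); apply/funext => g.
  by apply/eqP/negPn/negP => n0; apply: H; exists g.
exists (ball lam e%:C), (E (ball lam e%:C) g); split=> //.
  move=> z; rewrite -ball_normE /ball_ /= nmE ltcR nm_distC; exact: ltW.
by rewrite -(spectral_setIA hE) // setIid.
Qed.

Variables (A : operator X) (T : R -> X -> X).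
Hypothesis eA : op_equiv A (spectral_integral E S id).
Hypothesis sgT : C0_semigroup T.
Hypothesis gT : generates A T.

(** One near-eigenvector serves both times. The factors [Ct] and [Cs] depend on [lam] but not on the
    radius [d], which can therefore be taken small afterwards. *)
Lemma cexp_dist_le_opnorm (lam : R[i]) (s t : R) : S lam -> 0 <= s -> 0 <= t ->
  nm (cexp (t%:C * lam) - cexp (s%:C * lam)) <= opnorm (fun f => T t f - T s f).
Proof.
move=> Sl s0 t0; set N := opnorm _.
have bTS : bounded_operator (fun f => T t f - T s f).
  by apply: bounded_operatorB; apply: semigroup_bounded sgT _ _.
have [Kt Kt1 KtP] := semigroup_bounded_on sgT t.
have [Ks Ks1 KsP] := semigroup_bounded_on sgT s.
have [K K0 KP] := spectral_integral_near_eigen hE bS ES.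
pose Ct := t * (expR (t * nm lam) * Kt); pose Cs := s * (expR (s * nm lam) * Ks).
have Kt0 : 0 <= Kt by lra.
have Ks0 : 0 <= Ks by lra.
have Ct0 : 0 <= Ct by rewrite mulr_ge0 // mulr_ge0 ?expR_ge0.
have Cs0 : 0 <= Cs by rewrite mulr_ge0 // mulr_ge0 ?expR_ge0.
apply/ler_addgt0Pr => e e0.
have D0 : 0 < (Ct + Cs) * K + 1.
  by rewrite ltr_wpDl // mulr_ge0 ?addr_ge0 // ltW.
have d0 : 0 < e / ((Ct + Cs) * K + 1) by rewrite divr_gt0.
have eD : e = e / ((Ct + Cs) * K + 1) * ((Ct + Cs) * K + 1) by rewrite divfK // gt_eqF.
set d := e / _ in d0 eD; clearbody d.
have [U [f [bU Ud EUf f0]]] := spectral_support_near_eigen Sl d0.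
have [df Af] := KP lam d U f bU Ud EUf.
have dAf : dom A f by rewrite eA.1.
have [dTf eTf] := generatesE gT dAf.
have ht := semigroup_near_eigen sgT lam t0 Kt0 KtP dTf.
have hs := semigroup_near_eigen sgT lam s0 Ks0 KsP dTf.
rewrite eTf eA.2 // in ht hs.
have nf : 0 < nm f by rewrite nm_gt0.
rewrite -(ler_pM2r nf) -nmZ scalerBl.
have -> : cexp (t%:C * lam) *: f - cexp (s%:C * lam) *: f =
    (T t f - T s f) - ((T t f - cexp (t%:C * lam) *: f) - (T s f - cexp (s%:C * lam) *: f)).
  by rewrite [RHS]subrACA !subKr.
apply: le_trans (nmB _ _) _.
have := nmB (T t f - cexp (t%:C * lam) *: f) (T s f - cexp (s%:C * lam) *: f).
have := nm_le_opnorm f bTS; rewrite -/N.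
have := ler_wpM2l Ct0 Af; have := ler_wpM2l Cs0 Af.
have := mulr_gt0 d0 nf.
rewrite mulrA -/Ct in ht; rewrite mulrA -/Cs in hs.
rewrite eD; lra.
Qed.

Lemma norm_continuous_bounded (b : R) : immediately_norm_continuous T ->
  bounded_set [set lam : R[i] | S lam /\ b <= complex.Re lam].
Proof.
move=> /(_ 1 ltr01) nc.
(* Dividing by the modulus of exp lam, at least [expR b], leaves the threshold 1/2. *)
have eb0 : 0 < expR b / 2 by rewrite divr_gt0 ?expR_gt0.
have /cvgrPdist_le/(_ _ eb0)[d /= d0 dP] := nc.
pose h0 := Num.min (d / 2) 1.
have h00 : 0 < h0 by rewrite lt_min divr_gt0 /=.
have h01 : h0 <= 1 by rewrite ge_min lexx orbT.
have h0d : h0 < d.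
  by apply: le_lt_trans (_ : d / 2 < _); [rewrite ge_min lexx|lra].
(* Negative [h] is allowed; [h0 <= 1] keeps the time [1 + h] nonnegative. *)
have small lam h : S lam -> b <= complex.Re lam -> `|h| <= h0 ->
    nm (cexp (h%:C * lam) - 1) <= 2^-1.
  move=> Sl bl hh0; have h1 : 0 <= 1 + h.
    by move: hh0; rewrite ler_norml => /andP[]; lra.
  have bT : bounded_operator (fun f => T (1 + h) f - T 1 f).
    by apply: bounded_operatorB; apply: semigroup_bounded sgT _ _.
  have := dP (1 + h); rewrite /= opprD addrA subrr sub0r normrN.
  move=> /(_ (le_lt_trans hh0 h0d)); rewrite sub0r normrN ger0_norm ?opnorm_ge0 //.
  have := cexp_dist_le_opnorm Sl ler01 h1.
  have -> : cexp ((1 + h)%:C * lam) - cexp (1%:C * lam) =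
      cexp lam * (cexp (h%:C * lam) - 1).
    by rewrite rmorphD mulrDl !mul1r cexpD mulrBr mulr1.
  rewrite nmM nm_cexp => le1 le2.
  have el : expR b <= expR (complex.Re lam) by rewrite ler_expR.
  have := ler_wpM2r (nm_ge0 (cexp (h%:C * lam) - 1)) el => le3.
  have : expR b * nm (cexp (h%:C * lam) - 1) <= expR b * 2^-1 by lra.
  by rewrite ler_pM2l ?expR_gt0.
(* [1 / h0] bounds the real part above through [1 + x <= expR x <= 2], [b] bounds it below, and
   [pi / h0] bounds the imaginary part. *)
apply/bounded_set_nmP; exists (`|b| + 1 / h0 + pi / h0) => lam [Sl bl].
apply: le_trans (nm_le_ReIm _) _; apply: lerD.
  have : nm (cexp (h0%:C * lam)) <= 2.
    have := small lam h0 Sl bl; rewrite gtr0_norm // lexx => /(_ isT).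
    have := nm_lerB (cexp (h0%:C * lam)) 1; rewrite nm1; lra.
  rewrite nm_cexpM => le2.
  have := le_trans (expR_ge1Dx _) le2 => le3.
  have Rle : complex.Re lam <= 1 / h0 by rewrite ler_pdivlMr // mulrC; lra.
  have i0 : 0 <= 1 / h0 by rewrite divr_ge0 // ltW.
  rewrite ler_norml; apply/andP; split.
    have := ler_norm (- b); rewrite normrN; lra.
  by have := normr_ge0 b; lra.
rewrite leNgt; apply/negP => lt.
have pi0 : 0 < pi :> R by apply: pi_gt0.
have Im0 : 0 < `|complex.Im lam|.
  by apply: lt_trans lt; rewrite divr_gt0.
pose h := pi / complex.Im lam.
have hh0 : `|h| <= h0.
  rewrite /h normrM normfV (gtr0_norm pi0) ler_pdivrMr // mulrC.
  by rewrite -ler_pdivrMr // ltW.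
have := small lam h Sl bl hh0; apply/negP; rewrite -ltNge.
apply: lt_le_trans (nm_ge_Re _).
(* The imaginary part of [h lam] is exactly pi, so its exponential is a negative real number, at
   distance more than 1 from 1. *)
have -> : complex.Re (cexp (h%:C * lam) - 1) = - expR (h * complex.Re lam) - 1.
  rewrite /cexp cexp_real.
  have -> : complex.Im (h%:C * lam) = pi.
    case: lam @h hh0 Im0 {lt bl Sl} => x y /= _ y0.
    by rewrite mul0r addr0 divfK // -normr_gt0.
  by rewrite /= cospi sinpi mul0r subr0 mulrN1.
rewrite -opprD normrN; have := expR_gt0 (h * complex.Re lam) => e0.
rewrite gtr0_norm; lra.
Qed.

End NormContinuousImpliesBounded.

(** * The exponential semigroup *)

Section ContinuousComplex.
Variable R : realType.
Implicit Types (f g : R[i] -> R[i]) (z : R[i]).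

Lemma continuous_nmP f z : {for z, continuous f} <->
  forall e : R, 0 < e -> \forall w \near z, nm (f z - f w) <= e.
Proof. exact: (@cvg_nmP _ _ _ (nbhs z)). Qed.

Lemma continuousM_at f g z : {for z, continuous f} -> {for z, continuous g} ->
  {for z, continuous (fun w => f w * g w)}.
Proof.
move=> /continuous_nmP cf /continuous_nmP cg; apply/continuous_nmP => e e0.
have F0 : 0 < 2 * (nm (f z) + 1) by have := nm_ge0 (f z); lra.
have G0 : 0 < 2 * (nm (g z) + 1) by have := nm_ge0 (g z); lra.
have d1 : 0 < e / (2 * (nm (g z) + 1)) by rewrite divr_gt0.
have d2 : 0 < Num.min 1 (e / (2 * (nm (f z) + 1))) by rewrite lt_min ltr01 divr_gt0.
apply: filterS2 (cf _ d1) (cg _ d2) => w; rewrite le_min => fw /andP[gw1 gw].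
have -> : f z * g z - f w * g w = (f z - f w) * g w + f z * (g z - g w) by ring.
apply: le_trans (nmD _ _) _; rewrite !nmM.
have gB : nm (g w) <= nm (g z) + 1 by have := nm_lerB (g w) (g z); rewrite nm_distC; lra.
move: fw gw; rewrite !ler_pdivlMr // => fw gw.
have := ler_wpM2l (nm_ge0 (f z - f w)) gB; have := nm_ge0 (g z - g w); lra.
Qed.

Lemma continuousB_at f g z : {for z, continuous f} -> {for z, continuous g} ->
  {for z, continuous (fun w => f w - g w)}.
Proof.
move=> /continuous_nmP cf /continuous_nmP cg; apply/continuous_nmP => e e0.
have e2 : 0 < e / 2 by rewrite divr_gt0.
apply: filterS2 (cf _ e2) (cg _ e2) => w fw gw; rewrite subrACA.
by have := nmB (f z - f w) (g z - g w); lra.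
Qed.

Lemma continuous_cst_at (c : R[i]) z : {for z, continuous (fun _ : R[i] => c)}.
Proof.
apply/continuous_nmP => e e0; apply: filterS (nm_near z e0) => w _.
by rewrite subrr nm0 ltW.
Qed.

Lemma continuous_id_at z : {for z, continuous (fun w : R[i] => w)}.
Proof. by apply/continuous_nmP => e e0; apply: nm_near. Qed.

Lemma continuousV_at z : z != 0 -> {for z, continuous (fun w : R[i] => w^-1)}.
Proof. by move=> z0; apply: (@cvgV _ _ (nbhs z)). Qed.

Lemma continuous_cexpM (c : R[i]) z : {for z, continuous (fun w => cexp (c * w))}.
Proof.
have h := continuousM_at (@continuous_cst_at c z) (@continuous_id_at z).
exact: cvg_comp h (@continuous_cexp R (c * z)).
Qed.

End ContinuousComplex.

Section ExponentialSemigroup.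
Variables (R : realType) (X : completeNormedModType R[i]).
Variable E : set R[i] -> X -> X.
Hypothesis hE : spectral_measure E.
Variable S : set R[i].
Hypothesis bS : borel S.
Hypothesis ES : forall f, E S f = f.
Variable om : R.
Hypothesis om0 : 0 <= om.
Hypothesis S_om : forall z, S z -> complex.Re z <= om.

(** The indicator makes the symbol bounded on the whole plane, as the calculus requires, without
    changing the operator since [E S] is the identity. *)
Definition exp_symbol (t : R) (z : R[i]) : R[i] := indic S z * cexp (t%:C * z).

Definition exp_op t : X -> X := calculus E (exp_symbol t).

Lemma exp_symbol_nm t z : 0 <= t -> nm (exp_symbol t z) <= expR (t * om).
Proof.
move=> t0; rewrite nmM /indic; case: asboolP => Sz.
  by rewrite nm1 mul1r nm_cexpM ler_expR ler_wpM2l // S_om.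
by rewrite nm0 mul0r expR_ge0.
Qed.

Lemma totally_measurable_exp t : 0 <= t -> totally_measurable (exp_symbol t).
Proof.
move=> t0; apply: (@totally_measurable_cut _ S setT _ (expR (t * om)) bS).
- exact: openT.
- by [].
- by move=> z _; apply: continuous_cexpM.
by move=> z Sz; rewrite nm_cexpM ler_expR ler_wpM2l // S_om.
Qed.

(** A dominated convergence principle: symbols uniformly bounded and tending to 1 uniformly on each
    cutoff give operators tending strongly to the identity. The vector is split into its part on a
    large cutoff and a small rest. *)
Lemma calculus_strong_limit (G : R -> R[i] -> R[i]) (B : R) f :
  (forall t, 0 < t -> t <= 1 -> totally_measurable (G t)) ->
  (forall t z, 0 < t -> t <= 1 -> nm (G t z) <= B) ->
  (forall n (e : R), 0 < e -> exists2 d : R, 0 < d & forall t z,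
     0 < t -> t <= d -> t <= 1 -> cutoff S n z -> nm (G t z - 1) <= e) ->
  forall e : R, 0 < e -> exists2 d : R, 0 < d & forall t, 0 < t -> t <= d ->
    nm (calculus E (G t) f - f) <= e.
Proof.
move=> tG GB Glim e e0; have [K K0 KP] := is_calculus_bound hE.
have B0 : 0 <= B by apply: le_trans (GB 1 0 _ _) => //; apply: nm_ge0.
have D0 : 0 < 2 * (K * B + 1) by rewrite mulr_gt0 // ltr_wpDl // mulr_ge0 // ltW.
have d10 : 0 < e / (2 * (K * B + 1)) by rewrite divr_gt0.
have /cvgn_nmP/(_ _ d10)[n /(_ _ (leqnn n)) nP] := cutoff_cvg (f := f) hE bS ES.
have bc := borel_cutoff bS n.
have D20 : 0 < 2 * (K * (nm f + 1)) by rewrite !mulr_gt0 // ltr_wpDl // nm_ge0.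
have d20 : 0 < e / (2 * (K * (nm f + 1))) by rewrite divr_gt0.
have [d d0 dP] := Glim n _ d20.
exists (Num.min d 1) => [|t t0]; first by rewrite lt_min d0 ltr01.
rewrite le_min => /andP[td t1].
have tGt := tG t t0 t1; have ti := totally_measurable_indic bc.
have lG := calculus_lin hE tGt.
have -> : calculus E (G t) f - f = calculus E (G t) (f - E (cutoff S n) f)
    + (calculus E (G t) (E (cutoff S n) f) - E (cutoff S n) f)
    - (f - E (cutoff S n) f).
  by rewrite (linB lG) addrA subrK subrACA subrr subr0.
have h1 : nm (calculus E (G t) (f - E (cutoff S n) f)) <=
    K * B * nm (f - E (cutoff S n) f).
  by apply: KP (calculusP hE tGt) _ => z; apply: GB.
have h2 : nm (calculus E (G t) (E (cutoff S n) f) - E (cutoff S n) f) <=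
    K * (e / (2 * (K * (nm f + 1)))) * nm f.
  rewrite -(calculus_indic hE bc) -calculusM // -calculusB //; last first.
    exact: totally_measurableM hE _ _ tGt ti.
  apply: KP; first apply: calculusP => //.
    exact: totally_measurableB hE _ _ (totally_measurableM hE tGt ti) ti.
  move=> z /=; rewrite -{2}[indic _ z]mul1r -mulrBl nmM /indic.
  case: asboolP => cz; first by rewrite nm1 mulr1 dP.
  by rewrite nm0 mulr0 ltW.
have h3 : K * (e / (2 * (K * (nm f + 1)))) * nm f <= e / 2.
  have -> : K * (e / (2 * (K * (nm f + 1)))) * nm f = e / 2 * (nm f / (nm f + 1)).
    by field; rewrite !gt_eqF // ltr_wpDl // nm_ge0.
  by rewrite ler_piMr ?divr_ge0 ?(ltW e0) // ler_pdivrMr ?ltr_wpDl ?nm_ge0 // mul1r lerDl.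
have h4 : (K * B + 1) * nm (f - E (cutoff S n) f) <= e / 2.
  move: nP; rewrite ler_pdivlMr //; lra.
apply: le_trans (nmB _ _) _; have := nmD (calculus E (G t) (f - E (cutoff S n) f))
  (calculus E (G t) (E (cutoff S n) f) - E (cutoff S n) f).
lra.
Qed.

Lemma exp_op_small f (e : R) : 0 < e -> exists2 d : R, 0 < d &
  forall t, 0 < t -> t <= d -> nm (exp_op t f - f) <= e.
Proof.
apply: (@calculus_strong_limit exp_symbol (expR om)) => [t t0 _|t z t0 t1|n d d0].
- by apply: totally_measurable_exp; apply: ltW.
- apply: le_trans (exp_symbol_nm _ (ltW t0)) _.
  by rewrite ler_expR ler_piMl.
have D0 : 0 < 3 * n%:R * expR n%:R + 1 :> R.
  by rewrite ltr_wpDl // !mulr_ge0 // expR_ge0.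
exists (d / (3 * n%:R * expR n%:R + 1)) => [|t z t0 td t1 cz].
  by rewrite divr_gt0.
have [Sz _] := cz; have zn := cutoff_nm cz.
rewrite /exp_symbol /indic asboolT // mul1r.
have nR : complex.Re (t%:C * z) <= n%:R.
  rewrite cexp_real; have := le_trans (ler_norm _) (le_trans (nm_ge_Re z) zn) => zR.
  apply: le_trans (ler_wpM2l (ltW t0) zR) _.
  by rewrite ler_piMl.
apply: le_trans (cexpB1_le (ler0n _ n) nR) _.
rewrite nmM nmR gtr0_norm //; move: td; rewrite ler_pdivlMr // => td.
have := ler_wpM2l (ltW t0) zn => /(ler_wpM2r (expR_ge0 n%:R)); lra.
Qed.

Lemma exp_op_bounded t : 0 <= t -> bounded_operator (exp_op t).
Proof. by move=> t0; apply: calculus_bounded_operator => //; apply: totally_measurable_exp. Qed.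

Lemma exp_opD s t f : 0 <= s -> 0 <= t -> exp_op (s + t) f = exp_op s (exp_op t f).
Proof.
move=> s0 t0; rewrite /exp_op -calculusM //; try exact: totally_measurable_exp.
congr (calculus E _ f); apply/funext => z; rewrite /exp_symbol mulrACA.
by rewrite indicM setIid -cexpD -mulrDl -rmorphD.
Qed.

Lemma exp_op0 : exp_op 0 = id.
Proof.
apply/funext => f; rewrite -[RHS]ES -(calculus_indic hE bS); congr (calculus E _ f).
by apply/funext => z; rewrite /exp_symbol mul0r cexp0 mulr1.
Qed.

Lemma exp_op_C0_semigroup : C0_semigroup exp_op.
Proof.
split=> [t|||f]; first exact: exp_op_bounded.
- exact: exp_op0.
- by move=> s t s0 t0; apply/funext => f; apply: exp_opD.
apply/cvg_nmP => e e0; apply/near_at_right0P.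
have [d d0 dP] := exp_op_small f e0.
by exists d => // t t0 td; rewrite nm_distC dP.
Qed.

(* The difference quotient of the exponential relative to the identity, with
   its limiting value 1 at 0. *)
Definition exp_quotient (t : R) (z : R[i]) : R[i] :=
  indic S z * (if z == 0 then 1 else (cexp (t%:C * z) - 1) / (t%:C * z)).

(** The origin as a disc of radius 0, so that [borel_nm_le] applies. *)
Let Z : set R[i] := [set z | nm z <= 0].

Let ZP (z : R[i]) : Z z <-> z = 0.
Proof.
split=> [z0|->]; last by rewrite /Z /= nm0.
by apply: nm0_eq0; apply/eqP; rewrite eq_le nm_ge0 andbT.
Qed.

Let nm_quot (t : R) (z : R[i]) : 0 < t -> z != 0 ->
  nm ((cexp (t%:C * z) - 1) / (t%:C * z)) =
  nm (cexp (t%:C * z) - 1) / (t * nm z).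
Proof. by move=> t0 z0; rewrite nmM nmV nmM nmR gtr0_norm. Qed.

Let nm_quot_le (t : R) (z : R[i]) : 0 < t -> t <= 1 -> S z -> z != 0 ->
  nm ((cexp (t%:C * z) - 1) / (t%:C * z)) <= 3 * expR om.
Proof.
move=> t0 t1 Sz z0; have zp : 0 < nm z by rewrite nm_gt0.
rewrite nm_quot // ler_pdivrMr ?mulr_gt0 //.
have Rz : complex.Re (t%:C * z) <= om.
  rewrite cexp_real; apply: le_trans (ler_wpM2l (ltW t0) (S_om Sz)) _.
  by rewrite ler_piMl.
apply: le_trans (cexpB1_le om0 Rz) _.
by rewrite nmM nmR gtr0_norm // mulrAC.
Qed.

Lemma exp_quotient_nm t z : 0 < t -> t <= 1 -> nm (exp_quotient t z) <= 3 * expR om.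
Proof.
move=> t0 t1; have e1 : 1 <= expR om by rewrite -expR0 ler_expR.
rewrite nmM /indic; case: asboolP => Sz; last first.
  by rewrite nm0 mul0r mulr_ge0 // expR_ge0.
rewrite nm1 mul1r; case: eqP => [_|/eqP z0]; first by rewrite nm1; lra.
exact: nm_quot_le.
Qed.

(** The origin is split off because the formula for the quotient involves an inverse that is
    discontinuous there. *)
Lemma totally_measurable_exp_quotient t : 0 < t -> t <= 1 ->
  totally_measurable (exp_quotient t).
Proof.
move=> t0 t1; have bZ : borel Z by apply: borel_nm_le.
pose G z := indic (S `\` Z) z * ((cexp (t%:C * z) - 1) / (t%:C * z)).
have tG : totally_measurable G.
  apply: (@totally_measurable_cut _ _ [set z | 0 < nm (z - 0)] _ (3 * expR om)).
  - exact: borelD.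
  - exact: open_nm_gt.
  - by move=> z [_ nz]; rewrite /= subr0 ltNge; apply/negP.
  - move=> z; rewrite /= subr0 nm_gt0 => z0; apply: continuousM_at.
      apply: continuousB_at; [exact: continuous_cexpM|exact: continuous_cst_at].
    have -> : (fun w : R[i] => (t%:C * w)^-1) = (fun w => (t%:C)^-1 * w^-1).
      by apply/funext => w; rewrite invfM.
    by apply: continuousM_at; [exact: continuous_cst_at|exact: continuousV_at].
  - move=> z [Sz nz]; apply: nm_quot_le => //.
    by apply/eqP => z0; apply: nz; apply/ZP.
(* The coefficient -1 turns the sum of the two pieces into a difference, for
   [totally_measurableB]. *)
have tZ : totally_measurable (fun z => indic (S `&` Z) z * -1).
  apply: totally_measurableM hE _ _ _ _.
    by apply: totally_measurable_indic; apply: borelI.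
  exact: totally_measurable_cst hE _.
have -> : exp_quotient t = (fun z => G z - indic (S `&` Z) z * -1).
  apply/funext => z; rewrite /exp_quotient /G mulrN1 opprK.
  case: eqP => [->|/eqP z0].
    rewrite mulr0 invr0 !mulr0 add0r mulr1 -indicM.
    by rewrite [X in _ * X]/indic asboolT ?mulr1 //; apply/ZP.
  have nz : ~ Z z by move=> /ZP /eqP; apply/negP.
  rewrite -[indic (S `&` Z) z]indicM [indic Z z]/indic asboolF // mulr0 addr0.
  rewrite setDE -indicM [indic (~` Z) z]/indic asboolT //.
  by rewrite mulr1.
exact: totally_measurableB hE _ _ tG tZ.
Qed.

Lemma exp_quotient_small f (e : R) : 0 < e -> exists2 d : R, 0 < d &
  forall t, 0 < t -> t <= d -> nm (calculus E (exp_quotient t) f - f) <= e.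
Proof.
apply: (@calculus_strong_limit exp_quotient (3 * expR om)) => [||n d d0].
- exact: totally_measurable_exp_quotient.
- exact: exp_quotient_nm.
(* On the cutoff, dividing [cexpB1B_le] by the modulus of [t z] leaves at most [t * Q]. *)
pose Q : R := n%:R * ((3 + n%:R) * expR n%:R).
have Q0 : 0 <= Q by rewrite !mulr_ge0 ?expR_ge0 // addr_ge0.
exists (d / (Q + 1)) => [|t z t0 td t1 cz]; first by rewrite divr_gt0 // ltr_wpDl.
have [Sz _] := cz; have zn := cutoff_nm cz.
rewrite /exp_quotient /indic asboolT // mul1r.
case: eqP => [_|/eqP z0]; first by rewrite subrr nm0 ltW.
have tz0 : t%:C * z != 0.
  by rewrite mulf_neq0 // -nm_gt0 nmR normr_gt0 gt_eqF.
have zp : 0 < nm z by rewrite nm_gt0.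
have -> : (cexp (t%:C * z) - 1) / (t%:C * z) - 1 =
    (cexp (t%:C * z) - 1 - t%:C * z) / (t%:C * z).
  by rewrite [RHS]mulrBl divff.
rewrite nmM nmV ler_pdivrMr ?nm_gt0 //; apply: le_trans (cexpB1B_le _) _.
set r := nm (t%:C * z); have rE : r = t * nm z by rewrite /r nmM nmR gtr0_norm.
have r0 : 0 <= r by apply: nm_ge0.
have rn : r <= t * n%:R by rewrite rE ler_wpM2l // ltW.
have rn' : r <= n%:R by apply: le_trans rn _; rewrite ler_piMl.
rewrite expr2 -mulrA mulrC; apply: ler_wpM2r => //.
have le1 : (3 + r) * expR r <= (3 + n%:R) * expR n%:R.
  by apply: ler_pM; rewrite ?expR_ge0 ?ler_expR ?lerD2l // addr_ge0.
have q0 : 0 <= (3 + r) * expR r by rewrite mulr_ge0 ?expR_ge0 // addr_ge0.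
have := ler_pM r0 q0 rn le1; rewrite -mulrA -/Q => /le_trans; apply.
move: td; rewrite ler_pdivlMr ?ltr_wpDl //; lra.
Qed.

Lemma exp_symbol_quotient t z : t != 0 ->
  exp_symbol t z - indic S z = t%:C * (exp_quotient t z * z).
Proof.
move=> t0; rewrite /exp_symbol /exp_quotient.
have tc : t%:C != 0 :> R[i] by rewrite -nm_gt0 nmR normr_gt0.
case: eqP => [->|/eqP z0]; first by rewrite mulr0 cexp0 mulr1 subrr !mulr0.
by field; rewrite z0.
Qed.

Let B := spectral_integral E S id.

(** The symbols agree after truncation to a cutoff, where [z] is bounded. Both sides then pass to
    the limit: the left by strong convergence of the projections, the right because the quotient
    operator is bounded. *)
Lemma exp_op_quotient t f : 0 < t -> t <= 1 -> dom B f ->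
  exp_op t f - f = t%:C *: calculus E (exp_quotient t) (B f).
Proof.
move=> t0 t1 df; have tq := totally_measurable_exp_quotient t0 t1.
have te := totally_measurable_exp (ltW t0).
have bq := calculus_bounded_operator hE tq.
have lim1 : calculus E (exp_quotient t) (cut_op E S n f) @[n --> \oo] -->
    calculus E (exp_quotient t) (B f).
  exact: bounded_operator_cvg _ bq (spectral_integral_cvg hE bS df).
have lim2 := cutoff_cvg (f := exp_op t f - f) hE bS ES.
apply: (cvg_nm_unique lim2).
have -> : (fun n => E (cutoff S n) (exp_op t f - f)) =
    (fun n => t%:C *: calculus E (exp_quotient t) (cut_op E S n f)).
  apply/funext => n; have bc := borel_cutoff bS n.
  have ti := totally_measurable_indic bc; have tS := totally_measurable_indic bS.
  have tc := totally_measurable_cut_op bS n.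
  have tt := totally_measurable_cst hE t%:C.
  rewrite -{2}[f]ES -(calculus_indic hE bS) -calculusB // -(calculus_indic hE bc).
  rewrite -calculusM //; last exact: totally_measurableB hE _ _ te tS.
  rewrite -(calculus_cst hE) /cut_op -!calculusM //; last first.
    exact: totally_measurableM hE _ _ tt tq.
  congr (calculus E _ f); apply/funext => z.
  by rewrite exp_symbol_quotient ?gt_eqF //; ring.
have bt : bounded_operator (fun f => t%:C *: f : X).
  rewrite (_ : (fun _ => _) = calculus E (fun=> t%:C)).
    by apply: calculus_bounded_operator => //; apply: totally_measurable_cst hE _.
  by apply/funext => g; rewrite (calculus_cst hE).
exact: bounded_operator_cvg _ bt lim1.
Qed.

Lemma exp_op_generator f : dom B f ->
  dom (generator exp_op) f /\ generator exp_op f = B f.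
Proof.
move=> df; apply/generatorP => e e0.
have [d d0 dP] := exp_quotient_small (B f) e0.
exists (Num.min d 1) => [|t t0]; first by rewrite lt_min d0 ltr01.
rewrite le_min => /andP[td t1]; rewrite exp_op_quotient // -scalerBr nmZ nmR.
by rewrite gtr0_norm // mulrC ler_wpM2r ?(ltW t0) // dP.
Qed.

(** For the reverse inclusion, the cutoff projections commute with the semigroup, so the truncated
    integrals of [f] are the projections of [generator exp_op f]. These converge, which places [f]
    in the domain of the integral. *)
Lemma exp_op_generates (A : operator X) : op_equiv A B -> generates A exp_op.
Proof.
move=> eA.
have incl f : dom (generator exp_op) f -> dom B f /\ B f = generator exp_op f.
  move=> df; apply/(spectral_integral_domP hE bS).
  have -> : (fun n => cut_op E S n f) = (fun n => E (cutoff S n) (generator exp_op f)).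
    apply/funext => n; have bc := borel_cutoff bS n.
    have EP : E (cutoff S n) (E (cutoff S n) f) = E (cutoff S n) f.
      by rewrite -(spectral_setIA hE) // setIid.
    have [dP BP] := spectral_integral_bounded hE bS ES bc (@cutoff_nm _ S n) EP.
    have [_ gP] := exp_op_generator dP.
    have -> : cut_op E S n f = B (E (cutoff S n) f).
      rewrite BP -/(cut_op E S n) -(calculus_indic hE bc) /cut_op.
      have tc := totally_measurable_cut_op bS n.
      rewrite -calculusM //; last exact: totally_measurable_indic.
      congr (calculus E _ f); apply/funext => z.
      by rewrite mulrAC indicM setIid.
    rewrite -gP.
    suff [_ ->] : dom (generator exp_op) (E (cutoff S n) f) /\
        generator exp_op (E (cutoff S n) f) = E (cutoff S n) (generator exp_op f) by [].
    apply/generatorP => e e0.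
    have /bounded_operatorP[lP [M M0 MP]] := spectral_bounded hE bc.
    have M1 : 0 < M + 1 by rewrite ltr_wpDl.
    have e0' : 0 < e / (M + 1) by rewrite divr_gt0.
    have /generatorP/(_ _ e0')[d d0 dP'] := conj df (erefl (generator exp_op f)).
    exists (Num.min d 1) => [|t t0]; first by rewrite lt_min d0 ltr01.
    rewrite le_min => /andP[td t1].
    have -> : exp_op t (E (cutoff S n) f) = E (cutoff S n) (exp_op t f).
      rewrite -(calculus_indic hE bc) /exp_op calculus_comm //.
        exact: totally_measurable_exp (ltW t0).
      exact: totally_measurable_indic.
    rewrite -(linZ lP) -!(linB lP); apply: le_trans (MP _) _.
    have := dP' t t0 td; rewrite mulrAC ler_pdivlMr //.
    have := nm_ge0 (exp_op t f - f - t%:C *: generator exp_op f); lra.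
  have lim := cutoff_cvg (f := generator exp_op f) hE bS ES; exact: lim.
split.
  rewrite eA.1; apply/seteqP; split=> f; first by case/exp_op_generator.
  by case/incl.
move=> f df; have dB : dom B f by rewrite -eA.1.
by rewrite eA.2 // (exp_op_generator dB).2.
Qed.

Lemma exp_op_norm_continuous :
  (forall b : R, bounded_set [set lam : R[i] | S lam /\ b <= complex.Re lam]) ->
  immediately_norm_continuous exp_op.
Proof.
move=> hb t0 t00; apply/cvgrPdist_le => e e0.
have [K K0 KP] := is_calculus_bound hE.
have d0 : 0 < e / K by rewrite divr_gt0.
set d := e / K in d0.
(* To the left of [b], each exponential at a time at least [t0 / 2] is at most [d / 2]; [b <= 0]
   makes later times only smaller. *)
pose b := Num.min 0 (2 * ln (d / 2) / t0).
have d20 : 0 < d / 2 by rewrite divr_gt0.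
have bexp : expR (t0 / 2 * b) <= d / 2.
  rewrite -[leRHS](lnK d20) ler_expR.
  apply: le_trans (_ : t0 / 2 * (2 * ln (d / 2) / t0) <= _).
    by rewrite ler_wpM2l ?ge_min ?lexx ?orbT // divr_ge0 // ltW.
  rewrite le_eqVlt; apply/orP; left; apply/eqP; field; exact: lt0r_neq0.
have b0 : b <= 0 by rewrite ge_min lexx.
have /bounded_set_nmP[C0 C0P] := hb b.
pose C := Num.max 0 C0; have C00 : 0 <= C by rewrite le_max lexx.
have CP z : S z -> b <= complex.Re z -> nm z <= C.
  by move=> Sz bz; rewrite le_max C0P ?orbT.
pose M := expR (t0 * om) * (3 * C * expR C) + 1.
have M0 : 0 < M by rewrite ltr_wpDl // !mulr_ge0 ?expR_ge0.
(* [t0 / 2] keeps [t] in the range used for the left part, 1 keeps [(t - t0) z] within [C], and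
   [d / M] makes the difference on the bounded part at most [d]. *)
exists (Num.min (t0 / 2) (Num.min 1 (d / M))) => /=.
  by rewrite !lt_min ltr01 !divr_gt0.
move=> t /=; rewrite !lt_min => /and3P[td1 td2 td3].
have tt0 : t0 / 2 <= t by move: td1; rewrite ltr_norml => /andP[]; lra.
have t_0 : 0 <= t by apply: le_trans tt0; rewrite divr_ge0 // ltW.
have bo : bounded_operator (fun f => exp_op t f - exp_op t0 f).
  by apply: bounded_operatorB; apply: exp_op_bounded => //; apply: ltW.
rewrite sub0r normrN ger0_norm ?opnorm_ge0 //; apply: opnorm_le => //; first exact: ltW.
move=> f; have te := totally_measurable_exp t_0.
have te0 := totally_measurable_exp (ltW t00).
rewrite -calculusB //.
have -> : e = K * d by rewrite /d mulrC divfK // gt_eqF.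
apply: KP; first by apply: calculusP => //; exact: totally_measurableB hE _ _ te te0.
move=> z; rewrite /= /exp_symbol -mulrBr nmM /indic; case: asboolP => Sz; last first.
  by rewrite nm0 mul0r ltW.
rewrite nm1 mul1r; have [zb|bz] := ltP (complex.Re z) b.
  apply: le_trans (nmB _ _) _; rewrite !nm_cexpM.
  have neg s : t0 / 2 <= s -> expR (s * complex.Re z) <= d / 2.
    move=> s2; apply: le_trans bexp; rewrite ler_expR.
    have zb' := ltW zb; have s0 : 0 <= s by apply: le_trans s2; rewrite divr_ge0 // ltW.
    by apply: le_trans (ler_wpM2l s0 zb') _; rewrite ler_wnM2r.
  have := neg t tt0; have := neg t0; have : t0 / 2 <= t0 by lra.
  by move=> h /(_ h); lra.
have zC := CP z Sz bz.
have -> : cexp (t%:C * z) - cexp (t0%:C * z) =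
    cexp (t0%:C * z) * (cexp ((t - t0)%:C * z) - 1).
  by rewrite mulrBr -cexpD -mulrDl -rmorphD [t0 + _]addrC subrK mulr1.
have nz : nm ((t - t0)%:C * z) <= `|t0 - t| * C.
  by rewrite nmM nmR distrC ler_wpM2l.
have nzC : nm ((t - t0)%:C * z) <= C.
  by apply: le_trans nz _; rewrite ler_piMl // ltW.
have Rz : complex.Re ((t - t0)%:C * z) <= C.
  exact: le_trans (ler_norm _) (le_trans (nm_ge_Re _) nzC).
rewrite nmM nm_cexpM.
have h1 : expR (t0 * complex.Re z) <= expR (t0 * om).
  by rewrite ler_expR ler_wpM2l ?S_om // ltW.
have h2 := cexpB1_le C00 Rz.
have h3 : 3 * nm ((t - t0)%:C * z) * expR C <= `|t0 - t| * (3 * C * expR C).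
  by have := ler_wpM2r (expR_ge0 C) nz; lra.
apply: le_trans (ler_pM (expR_ge0 _) (nm_ge0 _) h1 (le_trans h2 h3)) _.
move: (ltW td3); rewrite ler_pdivlMr // /M.
have := normr_ge0 (t0 - t); lra.
Qed.

End ExponentialSemigroup.

(** * Semigroup operators are of scalar type *)

Section BoundedScalarOperators.
Variables (R : realType) (X : completeNormedModType R[i]).
Variable E : set R[i] -> X -> X.
Hypothesis hE : spectral_measure E.
Let Q := spectral_support E.
Variable r : R.
Hypothesis Qr : forall z, Q z -> nm z <= r.

Let bQ : borel Q := borel_spectral_support E.
Let EQ f : E Q f = f := spectral_support_id hE f.

Let tQ : totally_measurable (fun z => indic Q z * z) :=
  totally_measurable_cut_id bQ Qr.

Let B : X -> X := calculus E (fun z => indic Q z * z).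

Let bounded_scalar_equiv : op_equiv (total_operator B) (spectral_integral E Q id).
Proof.
split=> [|f _].
  apply/seteqP; split=> // f _.
  by have [] := spectral_integral_bounded hE bQ EQ bQ Qr (EQ f).
by have [_ ->] := spectral_integral_bounded hE bQ EQ bQ Qr (EQ f).
Qed.

Lemma bounded_scalar_resolvent (lam : R[i]) :
  ~ Q lam -> resolvent_set (total_operator B) lam.
Proof.
move=> nQ; have oQ : open (~` Q) by apply: closed_openC; apply: closed_spectral_support.
have /nbhs_ballP[[e e'] /=] := open_nbhs_nbhs (conj oQ nQ).
rewrite ltcE /= => /andP[/eqP -> e0] eQ.
have Qe z : Q z -> e <= nm (z - lam).
  move=> Qz; rewrite leNgt; apply/negP => lt; apply: (eQ z) Qz.
  by rewrite -ball_normE /ball_ /= nmE complexr0 ltcR nm_distC.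
have Q0 z : Q z -> z - lam != 0.
  by move=> Qz; rewrite -nm_gt0; apply: lt_le_trans (Qe z Qz).
pose G z := indic Q z * (z - lam)^-1.
have tG : totally_measurable G.
  apply: (@totally_measurable_cut _ Q [set z | 0 < nm (z - lam)] _ e^-1 bQ).
  - exact: open_nm_gt.
  - by move=> z Qz; rewrite /= nm_gt0 Q0.
  - move=> z; rewrite /= nm_gt0 => z0.
    have h := continuousB_at (@continuous_id_at R z) (@continuous_cst_at R lam z).
    exact: cvg_comp h (@continuousV_at R _ z0).
  - by move=> z Qz; rewrite nmV lef_pV2 ?posrE ?Qe // nm_gt0 Q0.
have tl := totally_measurable_cst hE lam.
have BG g : B (calculus E G g) - lam *: calculus E G g = g.
  rewrite /B -(calculus_cst hE) -!calculusM // -calculusB //; last 2 first.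
  - exact: totally_measurableM hE _ _ tQ tG.
  - exact: totally_measurableM hE _ _ tl tG.
  rewrite -[RHS]EQ -(calculus_indic hE bQ); congr (calculus E _ g).
  apply/funext => z; rewrite /G /indic; case: asboolP => Qz; last first.
    by rewrite !mul0r mulr0 subr0.
  by rewrite !mul1r -mulrBl divff // Q0.
exists (calculus E G); split=> [|g|f _] /=.
- exact: calculus_bounded_operator.
- by split=> //; apply: BG.
have lG := calculus_lin hE tG.
by rewrite (linB lG) (linZ lG) {1}/B calculus_comm // -/B BG.
Qed.

(** A resolvent bounded by [C] at a point of the support would contradict near-eigenvectors there;
    the radius [d] is chosen to make [C * K * d] at most 1/2. *)
Lemma bounded_scalar_spectrum : spectral_support E = spectrum (total_operator B).
Proof.
apply/seteqP; split=> lam; last first.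
  by move=> sp; apply: contrapT => /bounded_scalar_resolvent.
move=> Ql [S [/bounded_operatorP[lS [C C0 SC]] _ SB]].
have [K K0 KP] := spectral_integral_near_eigen hE bQ EQ.
have D0 : 0 < 2 * (C * K + 1) by rewrite mulr_gt0 // ltr_wpDl // mulr_ge0 // ltW.
have d0 : 0 < (2 * (C * K + 1))^-1 by rewrite invr_gt0.
have dE : (2 * (C * K + 1))^-1 * (2 * (C * K + 1)) = 1 by rewrite mulVf // gt_eqF.
set d := _^-1 in d0 dE; clearbody d.
have [U [f [bU Ud EUf f0]]] := spectral_support_near_eigen hE Ql d0.
have [df Bf] := KP _ _ U f bU Ud EUf.
have nf : 0 < nm f by rewrite nm_gt0.
have := SC (B f - lam *: f); rewrite (SB f) //= => le1.
have eB : B f = spectral_integral E Q id f by exact: (bounded_scalar_equiv.2 f Logic.I).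
rewrite -eB in Bf; have le2 := le_trans le1 (ler_wpM2l C0 Bf).
have : C * K * d <= 2^-1 by lra.
move=> /(ler_wpM2r (ltW nf)); lra.
Qed.

Lemma bounded_scalar_type : scalar_type_spectral (total_operator B).
Proof.
have bB : bounded_operator B by apply: calculus_bounded_operator.
split.
- by split=> // a f g _ _; split=> //; apply: (bounded_lin bB).
- by move=> U U0 _; rewrite setIT.
- rewrite /closed_operator.
  have -> : [set p : X * X | dom (total_operator B) p.1 /\ total_operator B p.1 = p.2] =
      (fun p : X * X => B p.1 - p.2) @^-1` [set 0].
    apply/seteqP; split=> -[x y] /=; first by move=> [_ ->]; rewrite subrr.
    by move=> /eqP; rewrite subr_eq0 => /eqP.
  apply: preimage_closed; last first.
    exact: (@accessible_closed_set1 X (hausdorff_accessible (@norm_hausdorff _ X))).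
  move=> p _; apply: cvgB; last exact: cvg_snd.
  have cB : continuous B by case: bB.
  by apply: (@cvg_comp _ _ _ fst B _ (nbhs p.1)); [exact: cvg_fst|exact: cB].
exists E; split; [exact: hE|exact: bounded_scalar_spectrum|].
by rewrite -bounded_scalar_spectrum; apply: bounded_scalar_equiv.
Qed.

End BoundedScalarOperators.

(** * The image of a spectral measure under a Borel map *)

Section ImageMeasure.
Variables (R : realType) (X : completeNormedModType R[i]).
Variable E : set R[i] -> X -> X.
Hypothesis hE : spectral_measure E.
Variable g : R[i] -> R[i].
Hypothesis bg : forall U, open U -> borel (g @^-1` U).

Definition image_measure (d : set R[i]) : X -> X := E (g @^-1` d).

Lemma image_spectral_measure : spectral_measure image_measure.
Proof.
have bp := borel_preimage bg.
split=> [d bd|d bd|||d d' bd bd'|d bd td f].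
- exact: spectral_bounded hE _ (bp _ bd).
- by rewrite /image_measure (spectral_proj hE (bp _ bd)).
- by rewrite /image_measure preimage_set0 (spectral_set0 hE).
- by rewrite /image_measure preimage_setT (spectral_setT hE).
- by rewrite /image_measure preimage_setI (spectral_setI hE) //; apply: bp.
rewrite /image_measure preimage_bigcup.
apply: (@spectral_sigma_additive _ _ _ hE (fun n => g @^-1` d n)) => [n|].
  exact: bp (bd n).
by apply/trivIsetP => i j _ _ ij; rewrite -preimage_setI (trivIsetP.1 td) // preimage_set0.
Qed.

(** Change of variables: a partition for the image measure pulls back along [g], and the two simple
    operators are the same by definition. *)
Lemma is_calculus_image G S :
  is_calculus image_measure G S -> is_calculus E (G \o g) S.
Proof.
move=> cG e /cG[T [p [c [bp pG pS]]]]; exists T, (p \o g), c; split=> // [t|z].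
  exact: (borel_preimage bg (bp t)).
exact: pG.
Qed.

End ImageMeasure.

(** * Scalar type of the operators of a generated semigroup *)

Section ExponentialScalarType.
Variables (R : realType) (X : completeNormedModType R[i]).
Variable E : set R[i] -> X -> X.
Hypothesis hE : spectral_measure E.
Let S := spectral_support E.
Variable om : R.
Hypothesis om0 : 0 <= om.
Hypothesis S_om : forall z, S z -> complex.Re z <= om.

Let bS : borel S := borel_spectral_support E.
Let ES f : E S f = f := spectral_support_id hE f.

Lemma exp_op_scalar_type t : 0 <= t -> scalar_type_spectral (total_operator (exp_op E S t)).
Proof.
move=> t0; pose g z := cexp (t%:C * z : R[i]).
have bg U : open U -> borel (g @^-1` U).
  move=> oU; apply: borel_open; rewrite openE => z Uz.
  apply: (@continuous_cexpM R t%:C z U); exact: open_nbhs_nbhs.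
pose E' := image_measure E g; have hE' := image_spectral_measure hE bg.
pose Q := spectral_support E'; have bQ : borel Q by apply: borel_spectral_support.
have EQ f : E (g @^-1` Q) f = f := spectral_support_id hE' f.
(* The preimage of the exterior of this disc misses [S], so the exterior is an open null set of the
   image measure. *)
have Qr z : Q z -> nm z <= expR (t * om).
  move=> Qz; rewrite leNgt; apply/negP => lt.
  have oU := @open_nm_gt R (expR (t * om)) 0.
  apply: (Qz _ oU); first by rewrite /= subr0.
  have bU := bg _ oU; apply/funext => f; rewrite /E' /image_measure.
  rewrite -{1}[f]ES -(spectral_setIA hE) //.
  rewrite (_ : _ `&` S = set0) ?(spectral_set0 hE) //.
  apply/seteqP; split=> // w [/= + Sw]; apply/negP.
  by rewrite subr0 -leNgt /g nm_cexpM ler_expR ler_wpM2l // S_om.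
(* The indicators of [S] and of the preimage of [Q] both integrate to the identity, so each may be
   inserted on the side where it is missing. *)
have -> : exp_op E S t = calculus E' (fun z => indic Q z * z).
  have tQ := totally_measurable_cut_id bQ Qr.
  have cQ := is_calculus_image bg (calculusP hE' tQ).
  have te := totally_measurable_exp bS S_om t0.
  have bgQ := borel_preimage bg bQ.
  apply/funext => f; rewrite -(calculusE hE cQ) -[RHS]/(calculus E _ f).
  rewrite -{1}[f]EQ -{2}[f]ES -(calculus_indic hE bgQ) -(calculus_indic hE bS).
  rewrite /exp_op -!calculusM //; try exact: totally_measurable_indic.
    congr (calculus E _ f); apply/funext => z; rewrite /exp_symbol /= -/(g z).
    by rewrite -[indic (g @^-1` Q) z]/(indic Q (g z)); ring.
  exact: is_calculus_tm cQ.
exact: (bounded_scalar_type hE' Qr).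
Qed.

Variable A : operator X.
Hypothesis eA : op_equiv A (spectral_integral E S id).
Variable T : R -> X -> X.
Hypothesis sgT : C0_semigroup T.
Hypothesis gT : generates A T.

(* Vectors whose spectral support is bounded are dense and lie in every power
   of the domain of A. *)
Lemma generated_semigroup_exp t : 0 <= t -> T t = exp_op E S t.
Proof.
move=> t0; apply: (@dense_bounded_eq _ _ [set f | exists n, E (cutoff S n) f = f]).
- exact: semigroup_bounded sgT _ t0.
- exact: (exp_op_bounded hE bS S_om t0).
- move=> f e e0; have lim := cutoff_cvg (f := f) hE bS ES.
  have /cvgn_nmP/(_ _ e0)[n /(_ _ (leqnn n)) nP] := lim.
  exists (E (cutoff S n) f) => //; exists n.
  by rewrite -(spectral_setIA hE) ?setIid //; apply: borel_cutoff.
move=> f [n Ef]; have bc := borel_cutoff bS n.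
have sgU := exp_op_C0_semigroup hE bS ES om0 S_om.
have gU := exp_op_generates hE bS ES om0 S_om eA.
have dom_cut h : E (cutoff S n) h = h -> dom A h /\ A h = cut_op E S n h.
  move=> Eh; have [dh eh] := spectral_integral_bounded hE bS ES bc (@cutoff_nm _ S n) Eh.
  have dAh : dom A h by rewrite eA.1.
  by rewrite eA.2.
have [df Af] := dom_cut f Ef.
apply: (semigroup_unique_dom2 sgT sgU gT gU t0 df).
by have [] := dom_cut (A f); rewrite Af // (cut_op_proj hE bS).
Qed.

End ExponentialScalarType.

(** The scalar type claim concerns every norm-continuous semigroup generated by [A], so uniqueness
    is used to reduce it to the exponential. *)
Theorem theorem3p1 (R : realType) (X : completeNormedModType R[i])
    (A : operator X) (scalarA : scalar_type_spectral A) :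
  ((exists T : R -> X -> X,
      [/\ C0_semigroup T, generates A T & immediately_norm_continuous T])
   <->
   (forall b : R,
      bounded_set [set lambda : R[i] | spectrum A lambda /\ b <= complex.Re lambda]))
  /\
  (forall T : R -> X -> X,
     C0_semigroup T -> generates A T -> immediately_norm_continuous T ->
     forall t : R, 0 <= t -> scalar_type_spectral (total_operator (T t))).
Proof.
(* From here on the spectrum of [A] is replaced by the support of [E]. *)
have [_ _ _ [E [hE <- eA]]] := scalarA.
have forward T : C0_semigroup T -> generates A T -> immediately_norm_continuous T ->
    forall b : R, bounded_set [set lam : R[i] | spectral_support E lam /\ b <= complex.Re lam].
  by move=> sgT gT ncT b; apply: (norm_continuous_bounded hE eA sgT gT).
have bound : (forall b : R, bounded_set
      [set lam : R[i] | spectral_support E lam /\ b <= complex.Re lam]) ->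
    exists2 om : R, 0 <= om & forall z, spectral_support E z -> complex.Re z <= om.
  (* The half-plane at 0 alone bounds the real parts above: points to its left have negative real
     part. *)
  move=> /(_ 0) /bounded_set_nmP[C CP]; exists `|C| => // z Sz.
  have [z0|/ltW z0] := leP 0 (complex.Re z); last exact: le_trans z0 _.
  apply: le_trans (ler_norm _) (le_trans (nm_ge_Re _) _).
  exact: le_trans (CP z (conj Sz z0)) (ler_norm _).
have bS := borel_spectral_support E; have ES := spectral_support_id hE.
split; first split=> [[T [sgT gT ncT]]|hb]; first exact: forward sgT gT ncT.
  have [om om0 S_om] := bound hb; exists (exp_op E (spectral_support E)); split.
  - exact: (exp_op_C0_semigroup hE bS ES om0 S_om).
  - exact: (exp_op_generates hE bS ES om0 S_om eA).
  - exact: (exp_op_norm_continuous hE bS S_om hb).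
move=> T sgT gT ncT t t0; have [om om0 S_om] := bound (forward T sgT gT ncT).
rewrite (generated_semigroup_exp hE om0 S_om eA sgT gT t0).
exact: (exp_op_scalar_type hE S_om t0).
Qed.
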